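(* Let $R=k[x_0,\ldots,x_n]$ be a polynomial ring over a field $k$ of any characteristic, let $1\le c<s$ be integers, and let $\mathcal F=\{F_1,\ldots,F_s\}$ be a set of $s$ forms in $R$ such that any $c+1$ of them form a regular sequence. Let $I_{c,\mathcal F}=\bigcap_{1\le j_1<\cdots<j_c\le s}(F_{j_1},\ldots,F_{j_c})$. If $I_{c,\mathcal F}$ is a linear star configuration, then for every $m\ge 1$ the ideal $I_{c,\mathcal F}^{(m)}$ has linear quotients. In particular, monomial star configurations have linear quotients.
   Context: $I_{c,\mathcal F}$ is a linear star configuration if $\deg(F_j)=1$ for all $j=1,\ldots,s$, and a monomial star configuration if $\mathcal F=\{x_0,\ldots,x_n\}$. For a homogeneous ideal $I\subseteq R$ and $m\ge1$, $I^{(m)}=\bigcap_{P\in \mathrm{Ass}(R/I)}(I^mR_P\cap R)$. A homogeneous ideal $I$ has linear quotients if there is a total order $h_1>\cdots>h_r$ on a minimal generating set $\{h_1,\ldots,h_r\}$ of $I$ such that for every $1\le i\le r-1$ the ideal $(h_1,\ldots,h_i):h_{i+1}$ is generated by linear forms. *)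

(* Defs.v *)
From mathcomp Require Import all_boot all_order all_algebra.
From mathcomp.multinomials Require Import mpoly.

Set Implicit Arguments.
Unset Strict Implicit.
Unset Printing Implicit Defensive.

Import GRing.Theory.
Local Open Scope ring_scope.

(* Ideals are Prop-valued predicates: membership is not a priori decidable,
   so the boolean ideals of ring_quotient do not apply. Equality of ideals is
   extensional. *)
Section Ideals.

Variable A : comNzRingType.
Implicit Types (I J P C S : A -> Prop) (f g : A).

Definition same_ideal I J : Prop := forall f, I f <-> J f.

Definition is_ideal I : Prop :=
  [/\ I 0, forall f g, I f -> I g -> I (f + g) & forall r f, I f -> I (r * f)].

Definition is_prime_ideal P : Prop :=
  [/\ is_ideal P, ~ P 1 & forall f g, P (f * g) -> P f \/ P g].

(* finite sums of products c * x with c in C and x in S *)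
Definition lincomb C S : A -> Prop := fun f =>
  exists r : seq (A * A),
    (forall u, u \in r -> C u.1 /\ S u.2) /\ f = \sum_(u <- r) u.1 * u.2.

Definition ideal_gen S : A -> Prop := lincomb (fun _ => True) S.

Definition ideal_gen_seq (s : seq A) : A -> Prop := ideal_gen (fun x => x \in s).

Definition ideal_pow I (m : nat) : A -> Prop :=
  ideal_gen (fun f =>
    exists t : 'I_m -> A, (forall i, I (t i)) /\ f = \prod_i t i).

Definition colon I g : A -> Prop := fun f => I (f * g).

(* P is in Ass(A/I): P is prime and is the annihilator of the class of some f
   in A/I. *)
Definition associated_prime I P : Prop :=
  is_prime_ideal P /\ exists f, same_ideal P (colon I f).

Definition minimal_generating_seq I (h : seq A) : Prop :=
  [/\ uniq h, same_ideal (ideal_gen_seq h) I &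
      forall S, (forall x, S x -> x \in h) -> same_ideal (ideal_gen S) I ->
        forall x, x \in h -> S x].

Definition regular_sequence (h : seq A) : Prop :=
  ~ ideal_gen_seq h 1 /\
  forall i, (i < size h)%N ->
    forall f, ideal_gen_seq (take i h) (h`_i * f) -> ideal_gen_seq (take i h) f.

End Ideals.

Section SymbolicPowers.

Variable A : idomainType.
Implicit Types (I J P : A -> Prop).

(* A_P as a subring of the fraction field of A *)
Definition localization P : {fraction A} -> Prop := fun x =>
  exists a b : A, ~ P b /\ x = tofrac a / tofrac b.

(* J A_P, the ideal of A_P generated by J *)
Definition ideal_localization P J : {fraction A} -> Prop :=
  lincomb (localization P) (fun x => exists2 a, J a & x = tofrac a).

Definition symbolic_power I (m : nat) : A -> Prop := fun f =>
  forall P, associated_prime I P -> ideal_localization P (ideal_pow I m) (tofrac f).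

End SymbolicPowers.

Section StarConfigurations.

Variables (k : fieldType) (n : nat).
Local Notation R := {mpoly k[n.+1]}.

(* Both the generators h and the ideal I are homogeneous, as is implicit for a
   minimal generating set of a homogeneous ideal. The ideal (h_1,...,h_i) is
   generated by take i h, and h_{i+1} is h`_i. *)
Definition has_linear_quotients (I : R -> Prop) : Prop :=
  exists h : seq R,
    [/\ forall f, f \in h -> f \is homog mdeg, minimal_generating_seq I h &
        forall i, (0 < i < size h)%N ->
          exists L : R -> Prop,
            (forall l, L l -> l \is 1.-homog) /\
            same_ideal (colon (ideal_gen_seq (take i h)) h`_i) (ideal_gen L)].

(* Each choice of c+1 of the F_j is listed in increasing order of the indices;
   for forms the order is immaterial. When 0 < c < s this forces the F_j to be
   pairwise distinct and of positive degree. *)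
Definition star_family (c s : nat) (F : 'I_s -> R) : Prop :=
  (forall j, F j \is homog mdeg) /\
  forall B : {set 'I_s}, #|B| = c.+1 -> regular_sequence [seq F j | j <- enum B].

Definition star_ideal (c s : nat) (F : 'I_s -> R) : R -> Prop := fun f =>
  forall B : {set 'I_s}, #|B| = c ->
    ideal_gen (fun x => exists2 j, j \in B & x = F j) f.

(* msize is one plus the total degree. *)
Definition linear_family (s : nat) (F : 'I_s -> R) : Prop :=
  forall j, msize (F j) = 2%N.

Definition variables : 'I_n.+1 -> R := fun j => 'X_j.

End StarConfigurations.

(* Main.v *)
Require Import Defs.
From mathcomp Require Import all_boot all_order all_algebra.
From mathcomp.multinomials Require Import mpoly.
From mathcomp Require Import zify ring.
From Stdlib Require Import Classical_Prop.

Set Implicit Arguments.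
Unset Strict Implicit.
Unset Printing Implicit Defensive.

Import GRing.Theory.

(** Write P_T for the ideal generated by the F_j with j in T, and F^a for the
product of the F_j ^ a_j.  Ideals generated by linear forms are prime; as any c+1
of the F_j are independent, P_T contains no F_l with l outside T once |T| <= c.
The symbolic power is the intersection of the P_B ^ m with |B| = c, because those
powers are primary.

The generators are the F^a for the minimal exponents a whose entries sum to at
least m over every c-subset of indices, exactly as if the F_j were variables.
[gen_exp_enumeration] lists these exponents, in order of increasing degree, so
that each a comes with a set T of fewer than c indices such that
- for j in T, some earlier exponent is bounded by a + e_j,
- every earlier exponent exceeds a at some j in T.
For variables this says that the successive colon ideals are the P_T.  It stays
true for the F_j ([monomial_colon]): by the second property the earlier
generators lie in the ideal Q of the F_j ^ (a_j + 1), j in T, and Q : F^a = P_T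
because each F_l with l outside T is regular modulo Q.

It remains to see that these products generate the symbolic power.  Let J be the
ideal that they generate.  Its filtration by the first i generators has
successive quotients R / P_T with |T| < c.  On each of them the ideal of the
locus where c+1 of the F_j vanish has depth at least 2, so the absence of
elements of R / J supported on that locus propagates from one step of the
filtration to the next ([saturated_adjoin]).  Away from that locus J agrees
with the intersection of the P_B ^ m: multiplied by a power of the product of
the F_j with j outside B, the ideal P_B ^ m falls into J
([mem_ideal_of_pow]).

That P_T is prime and that its powers are primary comes from the deformation
X_i |-> (X_i - l_i) + l_i t, where l_i is a projection of X_i to the span of the
F_j with j in T: the m-th power of P_T consists of the f whose image is
divisible by t ^ m ([deform_pow]).

The generators form a minimal generating set because their degrees do not
decrease and none lies in the ideal of the previous ones. *)

(** * Exponents of the generators *)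

Lemma superset_card (I : finType) (B : {set I}) d :
  #|B| <= d <= #|I| -> exists2 C : {set I}, B \subset C & #|C| = d.
Proof.
case/andP; elim: d => [|d IHd] leBd ledI.
  by exists B => //; apply/eqP; rewrite -leqn0.
have [eqBd|neqBd] := eqVneq #|B| d.+1; first by exists B.
have [||C sBC cardC] := IHd; [lia | lia |].
have [j jC] : exists j, j \notin C.
  by apply/existsP; apply: contraLR ledI => /existsPn/= all_C;
     rewrite -ltnNge ltnS -cardC subset_leq_card //; apply/subsetP=> j _;
     move/negPn: (all_C j).
exists (j |: C); first exact: subset_trans sBC (subsetUr _ _).
by rewrite cardsU1 jC cardC.
Qed.

Lemma eq_of_leq_sum (I : finType) (f g : I -> nat) :
  (forall i, f i <= g i) -> \sum_i g i <= \sum_i f i -> f =1 g.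
Proof.
move=> le_fg le_sum i; apply/eqP; rewrite eqn_leq le_fg /=.
move: le_sum; rewrite [leqLHS](bigD1 i) //= [leqRHS](bigD1 i) //=.
have : \sum_(j | j != i) f j <= \sum_(j | j != i) g j by exact: leq_sum.
by set x := \sum_(_ | _) _; set y := \sum_(_ | _) _; clear; lia.
Qed.

Section Exponents.

Variables s c m : nat.
Implicit Types (a b : 'I_s -> nat) (C : {set 'I_s}).

(** For independent variables these are the exponents of the monomials in the
intersection of the m-th powers of the ideals generated by c variables. *)
Definition admissible a : Prop :=
  forall C, #|C| = c -> m <= \sum_(j in C) a j.

Definition below t a : {set 'I_s} := [set j | a j < t].

(** The minimal admissible exponents with maximum t.  When fewer than c entries
are below t, the value of the sum says that a c-subset containing all of these
entries sums to m; fixing the total instead avoids choosing such a subset, and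
shows that the degree of a generator depends only on t. *)
Definition gen_exp t a : bool :=
  [&& [forall j, a j <= t], #|below t a| < c &
      \sum_j a j == m + (s - c) * t].

(** The truncated subtraction makes the entries t - 1 and t count alike: the
deficit measures how unbalanced an exponent is, up to permuting these two
values. *)
Definition deficit t a := \sum_j (t.-1 - a j).

Definition top_weight t a := \sum_(j < s | a j == t) j.

(** Increasing a_j for j in this set gives an exponent that dominates an earlier
generator.  For a_j = t - 1 the earlier generator exchanges a_j with an entry t
at a larger index i, which is why the order of the indices enters. *)
Definition colon_set t a : {set 'I_s} :=
  [set j | (a j).+1 < t] :|:
  [set j | ((a j).+1 == t) && [exists i : 'I_s, (a i == t) && (j < i)]].

Lemma gen_expP t a :
  reflect [/\ forall j, a j <= t, #|below t a| < c &
              \sum_j a j = m + (s - c) * t] (gen_exp t a).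
Proof.
apply: (iffP and3P) => -[h1 h2 h3]; split => //.
- by move=> j; move/forallP: h1.
- exact/eqP.
- exact/forallP.
- exact/eqP.
Qed.

Lemma card_top t a : (forall j, a j <= t) ->
  #|[set j | a j == t]| + #|below t a| = s.
Proof.
move=> le_t; rewrite -[RHS](card_ord s) -(cardsC (below t a)) addnC.
by congr (_ + #|pred_of_set _|); apply/setP=> j; rewrite !inE -leqNgt eqn_leq le_t.
Qed.

(** The s - c entries outside a c-subset are at most t each. *)
Lemma gen_exp_admissible t a : gen_exp t a -> admissible a.
Proof.
case/gen_expP => le_t _ sum_a C cardC.
have := sum_a; rewrite (bigID (mem C)) /= => eq_sum.
have : \sum_(j | j \notin C) a j <= (s - c) * t.
  have -> : (s - c) * t = \sum_(j | j \notin C) t.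
    rewrite sum_nat_const; congr (_ * _).
    have := cardC; have := cardsC C; rewrite card_ord => h1 h2.
    by rewrite -(eq_card (fun j => in_setC j C)); lia.
  by apply: leq_sum => j _; exact: le_t.
move: eq_sum; set x := \sum_(_ in _) _; set y := \sum_(_ | _) _; lia.
Qed.

Hypotheses (c_gt0 : 0 < c) (lt_cs : c < s) (m_gt0 : 0 < m).

(** Decrease entries as long as this preserves admissibility.  In an exponent
where this is no longer possible, each nonzero entry, in particular a maximal
one, belongs to a c-subset C with sum exactly m; exchanging that maximal entry
of C with an entry outside C cannot lower the sum, so all entries outside C are
maximal too. *)
Lemma admissible_gen_exp a : admissible a ->
  exists t g, gen_exp t g /\ forall j, g j <= a j.
Proof.
have [w] := ubnP (\sum_j a j).
elim: w a => // w IHw a le_w adm_a.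
have [/existsP[j /andP[aj_gt0 redj]]|irred] := boolP [exists j, (0 < a j) &&
  [forall C : {set 'I_s}, (#|C| == c) ==> (j \in C) ==> (m < \sum_(i in C) a i)]].
  (* [j] is an entry that can be decreased. *)
  pose a' i := a i - (i == j).
  have suma' (P : pred 'I_s) : P j ->
      (\sum_(i | P i) a' i).+1 = \sum_(i | P i) a i.
    move=> Pj; rewrite (bigD1 j) //= [RHS](bigD1 j) //= /a' eqxx.
    rewrite (eq_bigr a) => [|i /andP[_ /negPf->]]; last by rewrite subn0.
    by case: (a j) aj_gt0 => // x _; rewrite subSS subn0.
  have [||t [g [gen_g le_g]]] := IHw a'.
  - by rewrite -ltnS suma'.
  - move=> C cardC; have [jC|jC] := boolP (j \in C).
      by rewrite -ltnS suma' //; move/forallP/(_ C): redj; rewrite cardC eqxx jC.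
    rewrite (eq_bigr a) ?adm_a // => i iC; rewrite /a'.
    by case: eqP jC iC => [->/negPf->|_] //; rewrite subn0.
  by exists t, g; split => // j'; apply: leq_trans (le_g j') (leq_subr _ _).
have tight j : 0 < a j -> exists C, [/\ #|C| = c, j \in C & \sum_(i in C) a i = m].
  move=> aj; move/existsPn/(_ j): irred; rewrite aj /=.
  case/forallPn=> C; rewrite !negb_imply -leqNgt => /and3P[/eqP cC jC le].
  by exists C; split => //; apply/eqP; rewrite eqn_leq le adm_a.
have s_gt0 : 0 < s by lia.
pose j0 := [arg max_(j > Ordinal s_gt0) a j].
have maxj0 j : a j <= a j0 by rewrite /j0; case: arg_maxnP => // i _; apply.
exists (a j0), a; split => //.
have aj0_gt0 : 0 < a j0.
  rewrite lt0n; apply/eqP => aj0.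
  have [C cC] : exists C : {set 'I_s}, #|C| = c.
    have le_c : #|@set0 'I_s| <= c <= #|'I_s| by rewrite cards0 card_ord /=; lia.
    by have [C _ cC] := superset_card le_c; exists C.
  have sum0 : \sum_(j in C) a j = 0.
    by apply: big1 => j _; apply/eqP; rewrite -leqn0 -aj0.
  by have := adm_a C cC; rewrite sum0 leqNgt m_gt0.
have [C [cC j0C sumC]] := tight _ aj0_gt0.
have out j : j \notin C -> a j = a j0.
  move=> jC; apply/eqP; rewrite eqn_leq maxj0 /=.
  have cC' : #|j |: C :\ j0| = c.
    have jC0 : j \notin C :\ j0 by rewrite inE (negPf jC) andbF.
    by rewrite cardsU1 jC0 -cC [in RHS](cardsD1 j0 C) j0C.
  have := adm_a _ cC'; rewrite big_setU1 ?inE ?(negPf jC) ?andbF //=.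
  have : \sum_(i in C) a i = a j0 + \sum_(i in C :\ j0) a i by rewrite (big_setD1 j0).
  rewrite sumC; set x := \sum_(_ in _) _; lia.
apply/gen_expP; split => //.
- rewrite -cC (cardsD1 j0 C) j0C ltnS; apply/subset_leq_card/subsetP=> j.
  rewrite !inE => lt; apply/andP; split; first by apply: contraTneq lt => ->;
    rewrite ltnn.
  by apply: contraTT lt => /out ->; rewrite ltnn.
- rewrite (bigID (mem C)) /= sumC; congr (_ + _).
  rewrite (eq_bigr (fun=> a j0)) => [|j /out //].
  rewrite sum_nat_const -(eq_card (fun j => in_setC j C)); congr (_ * _).
  by have := cardsC C; rewrite card_ord; lia.
Qed.

Lemma gen_exp_gt0 t a : gen_exp t a -> 0 < t.
Proof.
case/gen_expP => le_t _ sum_a; rewrite lt0n; apply: contraTneq m_gt0 => t0.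
have := sum_a; rewrite big1 => [|j _]; first by rewrite t0; lia.
by have := le_t j; rewrite t0; lia.
Qed.

Lemma gen_exp_le t a : gen_exp t a -> t <= m.
Proof.
case/gen_expP => le_t lt_c sum_a.
have : #|[set j | a j == t]| * t <= \sum_j a j.
  rewrite -sum_nat_const [leqRHS](bigID (fun j => a j == t)) /=.
  under eq_bigl do rewrite inE.
  by rewrite (eq_bigr a) ?leq_addr // => j /eqP.
have := card_top le_t; rewrite sum_a => h1 h2.
have : (s - c).+1 * t <= m + (s - c) * t.
  by apply: leq_trans h2; rewrite leq_mul2r; apply/orP; right; lia.
by rewrite mulSn leq_add2r.
Qed.

Lemma gen_exp_top t a : gen_exp t a -> exists i, a i = t.
Proof.
case/gen_expP => le_t lt_c _; have := card_top le_t => h.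
have /card_gt0P[i] : 0 < #|[set j | a j == t]| by lia.
by rewrite inE => /eqP; exists i.
Qed.

Lemma card_colon_set t a : gen_exp t a -> #|colon_set t a| < c.
Proof.
case/gen_expP => _ lt_c _; apply: leq_ltn_trans lt_c.
apply/subset_leq_card/subsetP=> j; rewrite !inE => /orP[|/andP[/eqP<-]] //.
exact: ltnW.
Qed.

(** By degree, then more balanced exponents first, then exponents whose maximal
entries sit at smaller indices; remaining ties may be broken arbitrarily. *)
Definition earlier t a t' a' : bool :=
  (t < t') || (t == t') &&
  ((deficit t a < deficit t' a') || (deficit t a == deficit t' a') &&
   (top_weight t a < top_weight t' a')).

Definition transfer (i j : 'I_s) a : 'I_s -> nat :=
  fun l => a l + (l == j) - (l == i).

Lemma sum_transfer i j a : i != j -> 0 < a i ->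
  \sum_l transfer i j a l = \sum_l a l.
Proof.
move=> ij ai; apply/eqP; rewrite -(eqn_add2r (\sum_l (l == i))) -big_split /=.
have -> : \sum_l (l == i : nat) = \sum_l (l == j).
  by rewrite -!big_mkcond !big_pred1_eq.
rewrite -big_split /=; apply/eqP/eq_bigr => l _; rewrite /transfer.
case: (eqVneq l i) => [->|_]; first by rewrite (negPf ij); case: (a i) ai => // x;
  rewrite addn0 subn1 addn1.
by rewrite subn0 addn0.
Qed.

(** If a_j < t - 1, move a unit from a maximal entry to a_j; when c - 1 entries
are already below t this would create too many of them, and all maximal entries
can be decreased at once instead, which lowers the degree.  If a_j = t - 1, move
a unit from a maximal entry at a larger index. *)
Lemma colon_set_witness t a j : gen_exp t a -> j \in colon_set t a ->
  exists t' b, [/\ gen_exp t' b, earlier t' b t a &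
                   forall l, b l <= a l + (l == j)].
Proof.
move=> gen_a; have t_gt0 := gen_exp_gt0 gen_a.
have [le_t lt_c sum_a] := gen_expP _ _ gen_a.
have le_tr i l : transfer i j a l <= a l + (l == j) by exact: leq_subr.
have gen_tr i : a i = t -> a j < t -> #|below t (transfer i j a)| < c ->
    gen_exp t (transfer i j a).
  move=> ai aj card_tr; have ij : i != j by apply: contraTneq aj => <-; rewrite ai ltnn.
  apply/gen_expP; split => //; last by rewrite sum_transfer ?ai.
  move=> l; rewrite /transfer; have := le_t l; case: (eqVneq l j) => [->|_] _.
    by rewrite leq_subLR (leq_trans _ (leq_addl _ _)) // addn1.
  by rewrite addn0 (leq_trans (leq_subr _ _)).
have [gt_j|le_j] := ltnP (a j).+1 t.
  have [lt_N|ge_N] := ltnP #|below t a|.+1 c.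
    have [i ai] := gen_exp_top gen_a.
    have ij : i != j by apply: contraTneq gt_j => <-; rewrite ai ltnNge leqnSn.
    exists t, (transfer i j a); split => //.
      apply: gen_tr => //; first exact: ltnW.
      apply: leq_ltn_trans lt_N; apply: leq_trans (_ : #|i |: below t a| <= _).
        apply/subset_leq_card/subsetP=> l; rewrite !inE /transfer.
        by case: (l == i) => //=; rewrite subn0; apply: leq_ltn_trans (leq_addr _ _).
      by rewrite cardsU1 -add1n leq_add2r leq_b1.
    rewrite /earlier eqxx ltnn /=; apply/orP; left.
    rewrite /deficit [ltnRHS](bigD1 j) //= [ltnLHS](bigD1 j) //= -addSn leq_add //.
      by rewrite /transfer eqxx eq_sym (negPf ij) subn0 addn1; clear -gt_j; lia.
    apply: leq_sum => l /negPf lj; rewrite /transfer lj addn0.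
    by case: eqP => [->|_]; rewrite ?subn0 // ai /=; clear; lia.
  exists t.-1, (fun l => a l + (l == j) - (a l == t)); split; last first.
  - by move=> l; exact: leq_subr.
  - by rewrite /earlier prednK // leqnn.
  apply/gen_expP; split.
  - move=> l; have := le_t l; case: (eqVneq l j) => [->|_] /=; case: eqP;
      clear -gt_j t_gt0; lia.
  - apply: leq_ltn_trans lt_c; apply/subset_leq_card/subsetP=> l; rewrite !inE.
    by have := le_t l; case: eqP; clear -t_gt0; lia.
  - have eq_s := card_top le_t.
    have eq_M : #|[set l | a l == t]| = (s - c).+1 by clear -eq_s ge_N lt_c lt_cs; lia.
    apply/eqP; rewrite -(eqn_add2r (\sum_l (a l == t))) -big_split /=.
    have -> : \sum_l (a l == t : nat) = (s - c).+1.
      by rewrite -eq_M -sum1dep_card -big_mkcond.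
    rewrite (eq_bigr (fun l => a l + (l == j))) => [|l _]; last first.
      by case: eqP => [->|_]; clear -t_gt0; lia.
    rewrite big_split /= sum_a -[X in _ + X]big_mkcond big_pred1_eq addn1 -addnA addnS.
    by rewrite addnS eqSS eqn_add2l -{1}(prednK t_gt0) mulnS addnC.
rewrite !inE ltnNge le_j /= => /andP[/eqP aj /existsP[i /andP[/eqP ai lt_ji]]].
have aj_lt : a j < t by rewrite aj.
have ij : i != j by apply: contraTneq lt_ji => ->; rewrite ltnn.
exists t, (transfer i j a); split => //.
  apply: gen_tr => //; apply: leq_ltn_trans lt_c.
  have -> : #|below t a| = #|i |: (below t a :\ j)|.
    by rewrite cardsU1 !inE ai ltnn andbF [LHS](cardsD1 j) inE aj_lt.
  apply/subset_leq_card/subsetP=> l; rewrite !inE /transfer.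
  case: (l == i) => //=; rewrite subn0; case: eqP => [->|_] /=;
    first by rewrite addn1 aj ltnn.
  by rewrite addn0.
have tr_j : transfer i j a j = t by rewrite /transfer eqxx eq_sym (negPf ij) addn1 subn0.
have tr_i : transfer i j a i = t.-1 by rewrite /transfer eqxx (negPf ij) addn0 subn1 ai.
have tr_l l : l != i -> l != j -> transfer i j a l = a l.
  by rewrite /transfer => /negPf-> /negPf->; rewrite addn0 subn0.
rewrite /earlier eqxx /=; apply/orP; right; apply/orP; right; apply/andP; split.
  apply/eqP/eq_bigr => l _; have [->|li] := eqVneq l i; first by rewrite tr_i ai; clear;
    lia.
  have [->|lj] := eqVneq l j; first by rewrite tr_j -aj; clear; lia.
  by rewrite tr_l.
rewrite /top_weight (bigD1 j) ?tr_j //= [ltnRHS](bigD1 i) ?ai //= -addSn leq_add //.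
rewrite leq_eqVlt; apply/orP; left; apply/eqP/eq_bigl => l.
have [->|li] := eqVneq l i; first by rewrite tr_i andbF; clear -t_gt0; lia.
have [->|lj] := eqVneq l j; first by rewrite andbF (ltn_eqF aj_lt).
by rewrite tr_l.
Qed.

(** Assume b <= a on the colon set of a.  If the maximum of b is smaller, then
b <= a everywhere and b is smaller on too many entries for its total.  If the
maxima agree, b is at least as unbalanced as a, so the deficits are equal and b
arises from a by permuting the values t - 1 and t; every entry t of b that is
not one of a then has an index beyond those of all entries t of a, and the last
key puts b after a. *)
Lemma colon_set_separates t a t' b : gen_exp t a -> gen_exp t' b ->
  ~~ earlier t a t' b -> ~ (a =1 b) -> exists2 j, j \in colon_set t a & a j < b j.
Proof.
move=> gen_a gen_b not_later neq_ab.
have [le_t lt_c sum_a] := gen_expP _ _ gen_a.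
have [le_t' lt_c' sum_b] := gen_expP _ _ gen_b.
have t_gt0 := gen_exp_gt0 gen_a.
apply/exists_inP; apply: contraT => /exists_inPn/= le_ab; exfalso.
have {}le_ab j : j \in colon_set t a -> b j <= a j by move/le_ab; rewrite -leqNgt.
have low j : (a j).+1 < t -> b j <= a j by move=> h; apply: le_ab; rewrite !inE h.
move: not_later; rewrite /earlier negb_or -leqNgt leq_eqVlt => /andP[/orP[/eqP|]];
  last first.
  move=> lt_t _.
  have : \sum_j (b j + (a j == t) * (t - t')) <= \sum_j a j.
    apply: leq_sum => j _; have := le_t' j; have := le_t j; have := low j.
    by case: eqP; lia.
  rewrite big_split /= -big_distrl /= sum_a sum_b.
  have -> : \sum_j (a j == t : nat) = #|[set j | a j == t]|.
    by rewrite -sum1dep_card -big_mkcond.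
  have := card_top le_t => card_s le_sum.
  have : (s - c).+1 * (t - t') <= #|[set j | a j == t]| * (t - t').
    by rewrite leq_mul2r; apply/orP; right; lia.
  have : (s - c) * t = (s - c) * t' + (s - c) * (t - t').
    by rewrite -mulnDr subnKC // ltnW.
  by rewrite mulSn; lia.
move=> eqt; move: gen_b le_t' lt_c' sum_b;
  rewrite eqt => gen_b le_t' lt_c' sum_b {t' eqt}.
rewrite eqxx /= negb_or -leqNgt => /andP[le_D].
have eq_def j : t.-1 - a j = t.-1 - b j.
  move: j; apply: eq_of_leq_sum le_D => j; have := low j; case: ltnP => [_ /(_ isT)|].
    exact: leq_sub2l.
  by move=> h _; have -> : t.-1 - a j = 0 by clear -h; lia.
have eqD : deficit t a = deficit t b by apply: eq_bigr => j _; rewrite eq_def.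
rewrite eqD eqxx /= -leqNgt => le_W.
(* Equal deficits leave only the values t - 1 and t to be permuted. *)
have eq_pt j : a j + (b j == t) = b j + (a j == t).
  have := eq_def j; have := le_t j; have := le_t' j.
  by case: eqP; case: eqP; lia.
have [i0 /eqP ai0] := gen_exp_top gen_a.
have [p /eqP ap max_p] := @arg_maxnP _ i0 (fun i => a i == t) (@nat_of_ord s) ai0.
have lt_p j : b j = t -> a j <> t -> p < j.
  move=> bj naj; rewrite ltnNge leq_eqVlt; apply/negP => /orP[/eqP/val_inj jp|lt_jp].
    by rewrite jp in naj.
  have := eq_pt j; rewrite bj eqxx; case: eqP => // _; rewrite addn0 addn1 => aj.
  have: b j <= a j.
    by apply: le_ab; rewrite !inE aj eqxx ltnn; apply/existsP; exists p; rewrite ap eqxx.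
  by rewrite bj -aj ltnn.
have card_eq : \sum_j (b j == t : nat) = \sum_j (a j == t : nat).
  by apply/eqP; rewrite -(eqn_add2l (\sum_j a j)) -big_split /= (eq_bigr _ (fun j _ =>
    eq_pt j)) big_split /= sum_a sum_b.
have : \sum_(j < s) ((a j == t) * j + (b j == t) * p + ((b j == t) && (a j != t))) <=
       \sum_(j < s) ((b j == t) * j + (a j == t) * p).
  apply: leq_sum => j _; case: (b j =P t) => bj; case: (a j =P t) => aj //=.
  - by clear; lia.
  - by have := lt_p j bj aj; clear; lia.
  - have : j <= p by apply: max_p; apply/eqP.
    by clear; lia.
rewrite !big_split /= -!big_distrl /= card_eq.
have top_sum f : \sum_(j < s) (f j == t) * j = top_weight t f.
  by rewrite /top_weight [RHS]big_mkcond; apply: eq_bigr => j _; case: eqP;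
    rewrite ?mul1n.
rewrite !top_sum addnAC leq_add2r => le_W'.
have sum0 : \sum_(j < s) ((b j == t) && (a j != t)) = 0.
  by apply/eqP; rewrite -leqn0 -(leq_add2l (top_weight t a)) addn0;
    apply: leq_trans le_W' le_W.
apply: neq_ab => j; apply/esym; move: j; apply: eq_of_leq_sum;
  last by rewrite sum_a sum_b.
move=> j; have : (b j == t) && (a j != t) = false.
  by have /eqP := sum0; rewrite sum_nat_eq0 => /forallP/(_ j) /=; case: (_ && _).
by have := eq_pt j; case: (b j =P t); case: (a j =P t) => //= _ _; clear; lia.
Qed.

Lemma gen_exp_ext t a b : a =1 b -> gen_exp t a = gen_exp t b.
Proof.
move=> eq_ab; rewrite /gen_exp.
have -> : below t a = below t b by apply/setP => j; rewrite !inE eq_ab.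
have -> : [forall j, a j <= t] = [forall j, b j <= t] by apply: eq_forallb => j;
  rewrite eq_ab.
by rewrite (eq_bigr _ (fun j _ => eq_ab j)).
Qed.

Lemma earlier_ext t a a' t' b b' : a =1 a' -> b =1 b' ->
  earlier t a t' b = earlier t a' t' b'.
Proof.
have ext u f g : f =1 g -> (deficit u f = deficit u g) * (top_weight u f = top_weight u
  g).
  move=> fg; split; first by apply: eq_bigr => j _; rewrite fg.
  by apply: eq_bigl => j; rewrite fg.
by move=> /ext eqa /ext eqb; rewrite /earlier !eqa !eqb.
Qed.

Definition level a := \max_j a j.

Lemma level_ext a b : a =1 b -> level a = level b.
Proof. by move=> eq_ab; apply: eq_bigr => j _. Qed.

Lemma gen_exp_level t a : gen_exp t a -> level a = t.
Proof.
move=> gen_a; have [i ai] := gen_exp_top gen_a; have [le_t _ _] := gen_expP _ _ gen_a.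
apply/eqP; rewrite eqn_leq -{2}ai leq_bigmax andbT.
by apply/bigmax_leqP => j _.
Qed.

(** The minimal exponents, sorted by the three keys of the order; the sets T are
their colon sets. *)
Lemma gen_exp_enumeration : exists e : seq ('I_s -> nat),
  let e_ i := nth (fun=> 0) e i in
  [/\ forall i, i < size e -> exists t, gen_exp t (e_ i),
      forall t a, gen_exp t a -> exists2 i, i < size e & e_ i =1 a,
      forall i i', i' <= i < size e -> \sum_j e_ i' j <= \sum_j e_ i j &
      forall i, i < size e -> exists T : {set 'I_s},
        [/\ #|T| < c,
            forall j, j \in T ->
              exists2 i', i' < i & forall l, e_ i' l <= e_ i l + (l == j) &
            forall i', i' < i -> exists2 j, j \in T & e_ i j < e_ i' j]].
Proof.
pose E : finType := {ffun 'I_s -> 'I_m.+1}.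
pose exp (a : E) : 'I_s -> nat := fun j => a j.
pose le (a b : E) := ~~ earlier (level (exp b)) (exp b) (level (exp a)) (exp a).
have le_total : total le by move=> a b; rewrite /le /earlier; clear; lia.
have le_trans : transitive le by move=> a b d; rewrite /le /earlier; clear; lia.
have le_refl : reflexive le by move=> a; rewrite /le /earlier; clear; lia.
pose e0 := sort le [seq a <- enum E | gen_exp (level (exp a)) (exp a)].
have mem_e0 (a : E) : (a \in e0) = gen_exp (level (exp a)) (exp a).
  by rewrite mem_sort mem_filter mem_enum andbT.
have uniq_e0 : uniq e0 by rewrite sort_uniq filter_uniq ?enum_uniq.
have sorted_e0 : sorted le e0 by exact: sort_sorted.
have ex_e0 t a : gen_exp t a -> exists2 b : E, b \in e0 & exp b =1 a.
  move=> gen_a; have [le_t _ _] := gen_expP _ _ gen_a.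
  pose b : E := [ffun j => inord (a j)].
  have eq_ba : exp b =1 a.
    by move=> j; rewrite /exp ffunE inordK // ltnS (leq_trans (le_t j)) ?(gen_exp_le
      gen_a).
  exists b; rewrite // mem_e0.
  by rewrite (level_ext eq_ba) (gen_exp_ext _ eq_ba) (gen_exp_level gen_a).
pose a0 : E := [ffun=> ord0].
have nthE i : i < size e0 -> nth (fun=> 0) (map exp e0) i = exp (nth a0 e0 i).
  by move=> lti; rewrite (nth_map a0).
have gen_nth i : i < size e0 -> gen_exp (level (exp (nth a0 e0 i))) (exp (nth a0 e0 i)).
  by move=> lti; rewrite -mem_e0 mem_nth.
have le_nth i i' : i' <= i < size e0 -> le (nth a0 e0 i') (nth a0 e0 i).
  case/andP => lei lti; apply: (sorted_leq_nth le_trans le_refl) => //.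
  by rewrite inE (leq_ltn_trans lei).
exists (map exp e0); rewrite size_map /=; split.
- by move=> i lti; rewrite nthE //; exists (level (exp (nth a0 e0 i))); exact: gen_nth.
- move=> t a /ex_e0[b be0 eq_ba]; exists (index b e0); first by rewrite index_mem.
  by rewrite nthE ?index_mem // nth_index.
- move=> i i' /[dup] /le_nth le_i /andP[lei lti].
  have lti' := leq_ltn_trans lei lti.
  have [_ _] := gen_expP _ _ (gen_nth _ lti); have [_ _] := gen_expP _ _ (gen_nth _ lti').
  rewrite !nthE // => -> ->; rewrite leq_add2l leq_mul2l; apply/orP; right.
  by move: le_i; rewrite /le /earlier; clear; lia.
- move=> i lti; have gen_i := gen_nth i lti;
    exists (colon_set (level (exp (nth a0 e0 i))) (exp (nth a0 e0 i))).
  split; first exact: card_colon_set.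
  + move=> j /(colon_set_witness gen_i)[t [b [gen_b b_i le_b]]].
    have [b' b'e0 eq_b] := ex_e0 _ _ gen_b; exists (index b' e0).
      rewrite ltnNge; apply/negP => le_i.
      have /le_nth : i <= index b' e0 < size e0 by rewrite le_i index_mem.
      rewrite nth_index // /le; case/negP.
      rewrite (level_ext eq_b) (gen_exp_level gen_b).
      by rewrite (earlier_ext _ _ eq_b (frefl _)).
    by move=> l; rewrite !nthE ?index_mem // nth_index // eq_b.
  + move=> i' lt_i'; have lti' := ltn_trans lt_i' lti.
    rewrite !nthE //; apply: (colon_set_separates gen_i (gen_nth _ lti')).
      by apply: le_nth; rewrite ltnW.
    move=> eq_ii'; have /eqP : nth a0 e0 i = nth a0 e0 i'.
      by apply/ffunP => j; apply/val_inj/eq_ii'.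
    by rewrite nth_uniq // gtn_eqF.
Qed.

End Exponents.

(** * Ideals *)

Section IdealTheory.
Local Open Scope ring_scope.

Variable A : comNzRingType.
Implicit Types (I S : A -> Prop) (f g x : A).

Lemma ideal_sum I (J : Type) (r : seq J) (P : pred J) (G : J -> A) :
  is_ideal I -> (forall j, P j -> I (G j)) -> I (\sum_(j <- r | P j) G j).
Proof. by case=> I0 ID _ IG; elim/big_ind: _. Qed.

Lemma ideal_sub I f g : is_ideal I -> I f -> I g -> I (f - g).
Proof. by case=> _ ID IM If Ig; apply: ID => //; rewrite -mulN1r; apply: IM. Qed.

Lemma ideal_subr I f g : is_ideal I -> I (f - g) -> I g -> I f.
Proof. by case=> _ ID _ Ifg Ig; rewrite -[f](subrK g); apply: ID. Qed.

Lemma ideal_gen_ideal S : is_ideal (ideal_gen S).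
Proof.
split.
- by exists [::]; rewrite big_nil.
- move=> f g [r [Sr ->]] [r' [Sr' ->]]; exists (r ++ r'); rewrite big_cat; split=> //.
  by move=> u; rewrite mem_cat => /orP[/Sr|/Sr'].
- move=> a f [r [Sr ->]]; exists [seq (a * u.1, u.2) | u <- r]; split.
    by move=> _ /mapP[u /Sr[_ Su] ->].
  by rewrite big_map mulr_sumr; apply: eq_bigr => u _; rewrite mulrA.
Qed.

Lemma mem_ideal_gen S x : S x -> ideal_gen S x.
Proof.
move=> Sx; exists [:: (1, x)]; rewrite big_seq1 mul1r; split=> // u.
by rewrite inE => /eqP ->.
Qed.

Lemma ideal_gen_least S I : is_ideal I -> (forall x, S x -> I x) ->
  forall f, ideal_gen S f -> I f.
Proof.
move=> idI SI f [r [Sr ->]]; rewrite big_seq; apply: ideal_sum => // u /Sr[_ Su].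
by case: idI => _ _; apply; apply: SI.
Qed.

Lemma ideal_gen_mono S S' : (forall x, S x -> S' x) ->
  forall f, ideal_gen S f -> ideal_gen S' f.
Proof.
by move=> sub; apply: ideal_gen_least;
  [exact: ideal_gen_ideal|move=> x /sub/mem_ideal_gen].
Qed.

(** This is I + (x), as a predicate suited to induction on generators. *)
Lemma adjoin_ideal I x : is_ideal I -> is_ideal (fun f => exists r, I (f - r * x)).
Proof.
case=> I0 ID IM; split.
- by exists 0; rewrite mul0r subr0.
- move=> f g [r Ir] [r' Ir']; exists (r + r').
  by rewrite mulrDl opprD addrACA; apply: ID.
- by move=> a f [r Ir]; exists (a * r); rewrite -mulrA -mulrBr; apply: IM.
Qed.

Lemma ideal_gen_seq_rcons (h : seq A) x f :
  ideal_gen_seq (rcons h x) f <-> exists r, ideal_gen_seq h (f - r * x).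
Proof.
have idh := ideal_gen_ideal (fun y => y \in h); split.
  apply: (ideal_gen_least (adjoin_ideal x idh)) => y;
    rewrite mem_rcons inE => /predU1P[->|yh].
    by exists 1; rewrite mul1r subrr; case: idh.
  by exists 0; rewrite mul0r subr0; apply: mem_ideal_gen.
case=> r Ir; apply: (@ideal_subr _ _ (r * x)); first exact: ideal_gen_ideal.
  by apply: ideal_gen_mono Ir => y yh; rewrite mem_rcons inE yh orbT.
by case: (ideal_gen_ideal (fun y => y \in rcons h x)) => _ _; apply;
   apply: mem_ideal_gen; rewrite mem_rcons mem_head.
Qed.

Definition family_ideal (s : nat) (T : {set 'I_s}) (G : 'I_s -> A) : A -> Prop :=
  ideal_gen (fun x => exists2 j, j \in T & x = G j).

Section FamilyIdeal.
Variable s : nat.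
Implicit Types (T : {set 'I_s}) (G : 'I_s -> A).

Lemma family_ideal_ideal T G : is_ideal (family_ideal T G).
Proof. exact: ideal_gen_ideal. Qed.

Lemma mem_family_ideal T G j : j \in T -> family_ideal T G (G j).
Proof. by move=> jT; apply: mem_ideal_gen; exists j. Qed.

Lemma family_ideal_least T G I : is_ideal I -> (forall j, j \in T -> I (G j)) ->
  forall f, family_ideal T G f -> I f.
Proof. by move=> idI GI; apply: ideal_gen_least => // x [j jT ->]; apply: GI. Qed.

Lemma eq_family_ideal T G G' : {in T, G =1 G'} ->
  forall f, family_ideal T G f -> family_ideal T G' f.
Proof.
move=> eqG; apply: family_ideal_least; first exact: family_ideal_ideal.
by move=> j jT; rewrite eqG //; apply: mem_family_ideal.
Qed.

Lemma family_idealD1 T G j f : j \in T ->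
  family_ideal T G f <-> exists r, family_ideal (T :\ j) G (f - r * G j).
Proof.
move=> jT; have idT := family_ideal_ideal (T :\ j) G; split.
  apply: (family_ideal_least (adjoin_ideal (G j) idT)) => i iT;
    have [->|ij] := eqVneq i j.
    by exists 1; rewrite mul1r subrr; case: idT.
  by exists 0; rewrite mul0r subr0; apply: mem_family_ideal; rewrite !inE ij.
have idT' := family_ideal_ideal T G.
case=> r Ir; apply: (ideal_subr (g := r * G j) idT'); last first.
  by case: idT' => _ _; apply; exact: mem_family_ideal.
by apply: family_ideal_least Ir => // i; rewrite !inE => /andP[_];
  apply: mem_family_ideal.
Qed.

End FamilyIdeal.

Lemma same_ideal_trans I J K : same_ideal I J -> same_ideal J K -> same_ideal I K.
Proof. by move=> IJ JK f; split=> [/IJ/JK|/JK/IJ]. Qed.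

Lemma ideal_pow_ideal I m : is_ideal (ideal_pow I m).
Proof. exact: ideal_gen_ideal. Qed.

Lemma ideal_pow0 I f : ideal_pow I 0 f.
Proof.
have [_ _ mulP] := ideal_pow_ideal I 0; rewrite -[f]mulr1; apply: mulP.
by apply: mem_ideal_gen; exists (fun=> 0); split=> [[]//|]; rewrite big_ord0.
Qed.

Lemma ideal_powS I m f g : I f -> ideal_pow I m g -> ideal_pow I m.+1 (f * g).
Proof.
move=> If; have [P0 PD PM] := ideal_pow_ideal I m.+1.
apply: (@ideal_gen_least _ (fun g => ideal_pow I m.+1 (f * g))).
  split=> [|x y Px Py|a x Px]; first by rewrite mulr0.
    by rewrite mulrDr; apply: PD.
  by rewrite mulrCA; apply: PM.
move=> _ [t [It ->]]; apply: mem_ideal_gen.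
exists (fun i => if unlift ord0 i is Some i' then t i' else f); split.
  by move=> i; case: unliftP.
by rewrite big_ord_recl unlift_none; congr (_ * _); apply: eq_bigr => i _; rewrite liftK.
Qed.

(** The principle for proofs by induction on the exponent of a power. *)
Lemma ideal_pow_least I m J : is_ideal J ->
  (forall f g, I f -> ideal_pow I m g -> J (f * g)) ->
  forall f, ideal_pow I m.+1 f -> J f.
Proof.
move=> idJ IJ; apply: ideal_gen_least => // _ [t [It ->]].
rewrite big_ord_recl; apply: IJ => //; apply: mem_ideal_gen.
by exists (fun i => t (lift ord0 i)).
Qed.

Lemma ideal_pow_mono I J m : (forall f, I f -> J f) ->
  forall f, ideal_pow I m f -> ideal_pow J m f.
Proof.
by move=> IJ; apply: ideal_gen_mono => _ [t [It ->]]; exists t; split=> // i; apply/IJ.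
Qed.

Lemma ideal_pow_leq I m d : (m <= d)%N -> forall f, ideal_pow I d f -> ideal_pow I m f.
Proof.
move=> /subnK<-; elim: (d - m)%N => // k IHk; rewrite addSn.
apply: ideal_pow_least => [|f g _ /IHk]; first exact: ideal_pow_ideal.
by case: (ideal_pow_ideal I m) => _ _; apply.
Qed.

Lemma ideal_pow1 I : is_ideal I -> same_ideal (ideal_pow I 1) I.
Proof.
move=> idI f; split.
  apply: ideal_pow_least => // x y Ix _; rewrite mulrC.
  by case: idI => _ _; apply.
by move=> If; rewrite -[f]mulr1; apply: ideal_powS => //; apply: ideal_pow0.
Qed.

Lemma prime_prod P (J : Type) (r : seq J) (Q : pred J) (G : J -> A) :
  is_prime_ideal P -> (forall j, Q j -> ~ P (G j)) -> ~ P (\prod_(j <- r | Q j) G j).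
Proof.
case=> _ P1 PM nP; apply: (big_ind (fun x => ~ P x)) => // x y nx ny Pxy.
by case: (PM _ _ Pxy).
Qed.

Lemma prime_exp P f m : is_prime_ideal P -> ~ P f -> ~ P (f ^+ m).
Proof.
case=> _ P1 PM nPf; elim: m => [|d IHd]; first by rewrite expr0.
by rewrite exprS => Pff; case: (PM _ _ Pff).
Qed.

End IdealTheory.

(** * Products of generic elements: colon ideals and saturation *)

Section GenericFamily.
Local Open Scope ring_scope.

Variables (A : idomainType) (s c : nat) (F : 'I_s -> A).
Implicit Types (T B : {set 'I_s}) (a e : 'I_s -> nat) (f g : A).

(** The two facts about linear forms, any c+1 of which are independent, that
determine the colon ideals of their products. *)
Hypothesis prime_family : forall T, is_prime_ideal (family_ideal T F).
Hypothesis generic_family :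
  forall T l, (#|T| <= c)%N -> l \notin T -> ~ family_ideal T F (F l).

Definition monomial a : A := \prod_j F j ^+ a j.

(** The shift of the exponents makes [power_ideal T a] the ideal of the
F_j ^ (a_j + 1), j in T, which contains exactly those monomials that exceed a
somewhere on T; it also excludes the unit ideal. *)
Definition power_ideal T e : A -> Prop :=
  family_ideal T (fun j => F j ^+ (e j).+1).

Lemma power_ideal_ideal T e : is_ideal (power_ideal T e).
Proof. exact: family_ideal_ideal. Qed.

Lemma power_ideal0 T f : power_ideal T (fun=> 0%N) f <-> family_ideal T F f.
Proof. by split; apply: eq_family_ideal => j _; rewrite expr1. Qed.

Lemma power_ideal_leq T e e' : (forall j, j \in T -> e' j <= e j)%N ->
  forall f, power_ideal T e f -> power_ideal T e' f.
Proof.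
move=> le_e; apply: family_ideal_least; first exact: power_ideal_ideal.
move=> j jT; rewrite -(subnK (_ : (e' j).+1 <= (e j).+1)%N) ?ltnS ?le_e // exprD.
by case: (power_ideal_ideal T e') => _ _; apply;
   apply: (@mem_family_ideal _ _ _ (fun i => F i ^+ (e' i).+1)).
Qed.

Lemma mem_power_ideal T e j k g : j \in T -> (e j < k)%N -> 
  power_ideal T e (F j ^+ k * g).
Proof.
move=> jT lt_k; have [_ _ PM] := power_ideal_ideal T e.
rewrite -(subnK lt_k) exprD mulrC mulrA; apply: PM.
exact: (@mem_family_ideal _ _ _ (fun i => F i ^+ (e i).+1)).
Qed.

Definition reset j e : 'I_s -> nat := fun i => if i == j then 0%N else e i.

(** If F_j ^ e_j * f = v * F_j ^ (e_j + 1) modulo the other generators, then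
F_j ^ e_j can be cancelled, being regular modulo them: f = v * F_j.  The
regularity is a hypothesis restricted to smaller sets because its proof uses
this lemma. *)
Lemma power_ideal_reset T e j f :
  (forall T' e' l g, (#|T'| < #|T|)%N -> l \notin T' ->
     power_ideal T' e' (F l * g) -> power_ideal T' e' g) ->
  j \in T -> power_ideal T e (F j ^+ e j * f) -> power_ideal T (reset j e) f.
Proof.
move=> reg jT /(family_idealD1 _ _ jT)[v]; rewrite exprSr => Pv.
apply/(family_idealD1 _ _ jT); exists v; rewrite /reset eqxx expr1.
have {Pv} : power_ideal (T :\ j) e (F j ^+ e j * (f - v * F j)).
  by rewrite (_ : _ * _ = F j ^+ e j * f - v * (F j ^+ e j * F j)) //; ring.
have {}reg k g : power_ideal (T :\ j) e (F j ^+ k * g) -> power_ideal (T :\ j) e g.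
  elim: k => [|k IHk]; first by rewrite expr0 mul1r.
  rewrite exprS -mulrA => H; apply: IHk; apply: reg H; last by rewrite !inE eqxx.
  by rewrite [ltnRHS](cardsD1 j) jT.
by move/reg; apply: eq_family_ideal => i; rewrite !inE => /andP[/negPf->].
Qed.

(** When all exponents are 0 the ideal is prime.  Otherwise some e_j > 0; by
induction g lies in the ideal with e_j lowered by one, so that g = u * F_j ^ e_j
modulo the ideal.  Then F_l * u lies in the ideal with e_j replaced by 0, to
which induction applies again. *)
Lemma power_ideal_regular T e l g : (#|T| <= c)%N -> l \notin T ->
  power_ideal T e (F l * g) -> power_ideal T e g.
Proof.
have [n] := ubnP #|T|; elim: n T e l g => // n IHn T e l g lt_n leTc lT.
have reg T' e' l' g' : (#|T'| < #|T|)%N -> l' \notin T' ->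
    power_ideal T' e' (F l' * g') -> power_ideal T' e' g'.
  by move=> ltT; apply: IHn; [exact: leq_trans ltT _ | exact: leq_trans (ltnW ltT) _].
have [w] := ubnP (\sum_(j in T) e j)%N.
elim: w e g => // w IHw e g lt_w.
have [/existsP[j /andP[jT ej]]|] := boolP [exists j, (j \in T) && (0 < e j)%N];
  last first.
  move/existsPn => e0 Pg.
  have {}e0 j : j \in T -> e j = 0%N.
    by move=> jT; have := e0 j; rewrite jT /= -leqNgt leqn0 => /eqP.
  have toP f : power_ideal T e f <-> family_ideal T F f.
    by split; apply: eq_family_ideal => j /e0 ->; rewrite expr1.
  have [_ _ primeT] := prime_family T.
  by apply/toP; case: (primeT _ _ ((toP _).1 Pg)) => // /(generic_family leTc lT).
move=> Pg; have idP := power_ideal_ideal T e.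
pose e' i := if i == j then (e j).-1 else e i.
have sum_e i0 : (i0 < e j)%N -> (\sum_(i in T) (if i == j then i0 else e i) < w)%N.
  move=> lti0; rewrite -ltnS; apply: leq_ltn_trans lt_w.
  rewrite (bigD1 j) //= eqxx [ltnRHS](bigD1 j) //= -addSn leq_add //.
  by apply: leq_sum => i /andP[_ /negPf->].
have Pg' : power_ideal T e' g.
  apply: IHw; first by apply: sum_e; rewrite prednK.
  apply: power_ideal_leq Pg => i _; rewrite /e'; case: eqP => // ->; exact: leq_pred.
have [u Pu] : exists u, power_ideal (T :\ j) e (g - u * F j ^+ e j).
  move/(family_idealD1 _ _ jT): Pg' => [u]; rewrite /e' eqxx prednK // => Pu; exists u.
  by apply: eq_family_ideal Pu => i; rewrite !inE => /andP[/negPf->].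
have PT f : power_ideal (T :\ j) e f -> power_ideal T e f.
  apply: family_ideal_least => // i; rewrite !inE => /andP[_ iT].
  exact: (@mem_family_ideal _ _ _ (fun i => F i ^+ (e i).+1)).
have [_ _ mulP] := idP.
apply: (ideal_subr (g := u * F j ^+ e j) idP); first exact: PT.
have {Pg}Plu : power_ideal T e (F j ^+ e j * (F l * u)).
  have -> : F j ^+ e j * (F l * u) = F l * g - F l * (g - u * F j ^+ e j) by ring.
  by apply: ideal_sub => //; apply: mulP; apply: PT.
have {Plu}/IHw Ru := power_ideal_reset reg jT Plu.
have {Ru}/(family_idealD1 _ _ jT)[v] := Ru (sum_e _ ej); rewrite /reset eqxx expr1 => Pv.
have -> : u * F j ^+ e j = v * F j ^+ (e j).+1 + F j ^+ e j * (u - v * F j).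
  by rewrite exprSr; ring.
case: idP => _ addP _; apply: addP.
  by rewrite mulrC; apply: mem_power_ideal.
apply: mulP; apply: PT; apply: eq_family_ideal Pv => i;
  rewrite !inE => /andP[/negPf->] //.
Qed.

Lemma power_ideal_regular_prod T e (Q : pred 'I_s) (k : 'I_s -> nat) g :
  (#|T| <= c)%N -> (forall i, Q i -> i \notin T) ->
  power_ideal T e ((\prod_(i | Q i) F i ^+ k i) * g) -> power_ideal T e g.
Proof.
move=> leTc QT; move: g; elim/big_ind: _ => [g|x y IHx IHy g|i Qi g].
- by rewrite mul1r.
- by rewrite -mulrA => /IHx/IHy.
- elim: (k i) => [|d IHd]; first by rewrite expr0 mul1r.
  by rewrite exprS -mulrA => /(power_ideal_regular leTc (QT i Qi)).
Qed.

(** The F_l with l outside T cancel by regularity; cancelling the powers of the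
F_j with j in T one by one lowers the exponents of the ideal to 0. *)
Lemma power_ideal_colon T a f : (#|T| <= c)%N ->
  power_ideal T a (f * monomial a) -> family_ideal T F f.
Proof.
move=> leTc; rewrite mulrC /monomial (bigID (mem T)) /= [_ * \prod_(i | _ \notin _)
  _]mulrC -mulrA.
move/power_ideal_regular_prod => /(_ leTc (fun _ => id)).
rewrite -big_enum /= => Pf.
have claim (r : seq 'I_s) e g : uniq r -> {subset r <= T} -> {in r, e =1 a} ->
    power_ideal T e ((\prod_(i <- r) F i ^+ a i) * g) ->
    power_ideal T (fun i => if i \in r then 0%N else e i) g.
  elim: r e g => [|j r IHr] e g /=; first by move=> _ _ _; rewrite big_nil mul1r.
  case/andP=> jr uniq_r sub_r eq_e; rewrite big_cons -mulrA -{1}(eq_e j) ?mem_head //.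
  have jT : j \in T by apply: sub_r; rewrite mem_head.
  move/power_ideal_reset => /(_ _ jT) H.
  have {H}/IHr : power_ideal T (reset j e) ((\prod_(i <- r) F i ^+ a i) * g).
    by apply: H => T' e' l h ltT; apply: power_ideal_regular;
      apply: leq_trans (ltnW ltT) leTc.
  move=> /(_ uniq_r) H;
    have {H} : power_ideal T (fun i => if i \in r then 0%N else reset j e i) g.
    apply: H => i ir; first by apply: sub_r; rewrite inE ir orbT.
    rewrite /reset eq_e ?inE ?ir ?orbT //.
    by rewrite (_ : (i == j) = false) //; apply: contraNF jr => /eqP <-.
  by apply: eq_family_ideal => i _; rewrite inE /reset; case: eqP => //= _;
    case: (i \in r).
have sub_enum : {subset enum T <= T} by move=> j; rewrite mem_enum.
apply: (power_ideal0 T f).1.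
by apply: power_ideal_leq (claim _ _ _ (enum_uniq T) sub_enum (fun _ _ => erefl) Pf).
Qed.

Lemma power_ideal_monomial T a b j : j \in T -> (a j < b j)%N ->
  power_ideal T a (monomial b).
Proof. by move=> jT lt_j; rewrite /monomial (bigD1 j) //=; apply: mem_power_ideal. Qed.

Lemma monomialD a b : monomial (fun j => a j + b j)%N = monomial a * monomial b.
Proof. by rewrite /monomial -big_split; apply: eq_bigr => j _; rewrite exprD. Qed.

Lemma eq_monomial a b : a =1 b -> monomial a = monomial b.
Proof. by move=> eq_ab; apply: eq_bigr => j _; rewrite eq_ab. Qed.

Lemma monomial1 j : monomial (fun l => l == j) = F j.
Proof.
rewrite /monomial (bigD1 j) //= eqxx expr1 big1 ?mulr1 // => i /negPf->.
exact: expr0.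
Qed.

Lemma monomial_leq a b : (forall j, a j <= b j)%N -> exists g, monomial b = g * monomial
  a.
Proof.
move=> le_ab; exists (monomial (fun j => b j - a j)%N); rewrite -monomialD.
by apply: eq_monomial => j; rewrite subnK.
Qed.

Section LinearQuotients.

Variable es : seq ('I_s -> nat).
Let e_ i := nth (fun=> 0%N) es i.
Let h := [seq monomial a | a <- es].

(** The colon ideal cannot exceed P_T since the previous generators lie in the
ideal of the F_j ^ (a_j + 1), j in T; it contains F_j because a + e_j dominates
an earlier exponent. *)
Lemma monomial_colon i T : (i < size es)%N -> (#|T| <= c)%N ->
  (forall j, j \in T -> exists2 i', (i' < i)%N &
     forall l, (e_ i' l <= e_ i l + (l == j))%N) ->
  (forall i', (i' < i)%N -> exists2 j, j \in T & (e_ i j < e_ i' j)%N) ->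
  same_ideal (colon (ideal_gen_seq (take i h)) h`_i) (family_ideal T F).
Proof.
move=> lti leTc witness sep f.
have hE i' : (i' < size es)%N -> h`_i' = monomial (e_ i').
  by move=> lti'; rewrite (nth_map (fun=> 0%N)).
have mem_h x : x \in take i h -> exists2 i', (i' < i)%N & x = monomial (e_ i').
  case/(nthP 0) => i'; rewrite size_take size_map lti => lt_i' <-; exists i' => //.
  by rewrite nth_take // hE // (ltn_trans lt_i').
rewrite /colon hE //; split.
  move=> Jf; apply: (@power_ideal_colon T (e_ i)) => //.
  apply: ideal_gen_least Jf; first exact: power_ideal_ideal.
  by move=> x /mem_h[i' /sep[j jT lt_j] ->]; apply: power_ideal_monomial lt_j.
have [J0 JD JM] := ideal_gen_ideal (fun x => x \in take i h).
apply: (@family_ideal_least _ _ _ _ (fun f => ideal_gen_seq (take i h) (f * monomial (e_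
  i)))).
  split=> [|x y Jx Jy|x y Jy]; first by rewrite mul0r.
    by rewrite mulrDl; apply: JD.
  by rewrite -mulrA; apply: JM.
move=> j /witness[i' lt_i' le_i'].
have [g eq_g] := monomial_leq le_i'.
rewrite mulrC -(monomial1 j) -monomialD eq_g; apply: JM; apply: mem_ideal_gen.
rewrite -hE ?(ltn_trans lt_i') // -(nth_take 0 lt_i') mem_nth //.
by rewrite size_take size_map lti.
Qed.

End LinearQuotients.

Section Saturation.

Variable m : nat.
Hypothesis (m_gt0 : (0 < m)%N).

(** As B runs over the c-subsets, these products cut out the locus where at least
c+1 of the F_j vanish. *)
Definition outer B : A := \prod_(j | j \notin B) F j ^+ m.

(** The quotient A / I has no nonzero element killed by all the products above,
that is, its zeroth local cohomology along that locus vanishes. *)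
Definition saturated (I : A -> Prop) : Prop :=
  forall f, (forall B, #|B| = c -> I (outer B * f)) -> I f.

Lemma outer_regular T B f : (#|T| <= c)%N -> T \subset B ->
  family_ideal T F (outer B * f) -> family_ideal T F f.
Proof.
move=> leTc sTB /(power_ideal0 T _).2 Pf; apply: (power_ideal0 T f).1.
apply: (power_ideal_regular_prod leTc _ Pf) => i.
by apply: contra; apply: (subsetP sTB).
Qed.

(** The quotient of I + (h) by I is isomorphic to A / P_T, and the lemma amounts
to the vanishing of the first local cohomology of A / P_T.  Explicitly, write
outer B * f = r_B * h modulo I.  The r_B are unique modulo P_T, and
outer B' * r_B = outer B * r_B' there.  For B containing T and j outside B,
choosing B' to contain T and j shows that F_j ^ m divides r_B modulo P_T.  As the
F_j are pairwise coprime modulo P_T, the whole product outer B divides r_B; by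
the same relations, the quotient u satisfies r_B' = outer B' * u modulo P_T for
every B'.  Hence outer B' * (f - u * h) is in I for all B'. *)
Lemma saturated_adjoin (I : A -> Prop) h T : is_ideal I -> (c <= s)%N -> (#|T| < c)%N ->
  same_ideal (colon I h) (family_ideal T F) -> saturated I ->
  saturated (fun f => exists r, I (f - r * h)).
Proof.
move=> idI le_cs ltTc colonE satI f adj_f.
have [I0 ID IM] := idI; have leTc := ltnW ltTc.
have idP := family_ideal_ideal T F; have [_ PD PM] := idP.
have cross B B' r r' : I (outer B * f - r * h) -> I (outer B' * f - r' * h) ->
    family_ideal T F (outer B' * r - outer B * r').
  move=> Ir Ir'; apply/colonE; rewrite /colon.
  have -> : (outer B' * r - outer B * r') * h =
    outer B * (outer B' * f - r' * h) - outer B' * (outer B * f - r * h) by ring.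
  by apply: ideal_sub => //; apply: IM.
pose e j (i : 'I_s) := if i == j then m.-1 else 0%N.
have family_power j g : j \notin T -> family_ideal T F g -> power_ideal (j |: T) (e j) g.
  move=> jT; apply: family_ideal_least; first exact: power_ideal_ideal.
  move=> i iT; rewrite -[F i]mulr1 -(expr1 (F i)); apply: mem_power_ideal.
    by rewrite !inE iT orbT.
  by rewrite /e; case: eqP => // eq_ij; rewrite eq_ij (negPf jT) in iT.
have cardU j : j \notin T -> (#|j |: T| <= c)%N by move=> jT; rewrite cardsU1 jT.
have [B0 sTB0 cardB0] : exists2 B : {set 'I_s}, T \subset B & #|B| = c.
  by apply: superset_card; rewrite leTc card_ord.
have [r0 Ir0] := adj_f B0 cardB0.
(* B contains T and j, so outer B is prime to F_j modulo P_T. *)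
have div j : j \notin B0 -> power_ideal (j |: T) (e j) r0.
  move=> jB0; have jT : j \notin T by apply: contra jB0; apply: (subsetP sTB0).
  have [B sjTB cardB] : exists2 B : {set 'I_s}, j |: T \subset B & #|B| = c.
    by apply: superset_card; rewrite cardU // card_ord.
  have [r Ir] := adj_f B cardB.
  apply: (@power_ideal_regular_prod _ _ (fun i => i \notin B) (fun=> m));
    first exact: cardU.
    by move=> i; apply: contra; apply: (subsetP sjTB).
  apply: (ideal_subr (g := outer B0 * r) (power_ideal_ideal _ _)).
    exact/family_power/cross.
  rewrite /outer (bigD1 j) //= -mulrA; apply: mem_power_ideal; first exact: setU11.
  by rewrite /e eqxx prednK.
(* Modulo P_T the prime powers F_j ^ m, j in D, are pairwise coprime, so that
   divisibility by each of them gives divisibility by their product. *)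
have factor (D : seq 'I_s) : uniq D -> {in D, forall j, j \notin B0} ->
    exists u, family_ideal T F (r0 - (\prod_(j <- D) F j ^+ m) * u).
  elim: D => [|j D IHD] /=.
    by exists r0; rewrite big_nil mul1r subrr; case: idP.
  case/andP=> jD uniq_D notB0.
  have [u Pu] := IHD uniq_D (fun i iD => notB0 i (mem_behead (s := j :: D) iD)).
  have jB0 : j \notin B0 by apply: notB0; rewrite mem_head.
  have jT : j \notin T by apply: contra jB0; apply: (subsetP sTB0).
  have /power_ideal_regular_prod : power_ideal (j |: T) (e j) ((\prod_(i | i \in D) F i
    ^+ m) * u).
    rewrite -big_uniq //= (_ : _ * u = r0 - (r0 - (\prod_(i <- D) F i ^+ m) * u));
      last by ring.
    by apply: ideal_sub; [exact: power_ideal_ideal | exact: div | exact: family_power].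
  have DjT i : i \in D -> i \notin j |: T.
    move=> iD; rewrite !inE negb_or; apply/andP; split;
      first by apply: contraNneq jD => <-.
    by apply: contra (notB0 i (mem_behead (s := j :: D) iD)); apply: (subsetP sTB0).
  move=> /(_ (cardU j jT) DjT)/(family_idealD1 _ _ (setU11 j T))[v Pv]; exists v.
  rewrite /e eqxx prednK // in Pv.
  have {}Pv : family_ideal T F (u - v * F j ^+ m).
    move: Pv; rewrite setU1K //; apply: eq_family_ideal => i iT.
    by rewrite (_ : (i == j) = false) ?expr1 //; apply: contraNF jT => /eqP <-.
  rewrite big_cons (_ : _ - _ = r0 - (\prod_(i <- D) F i ^+ m) * u +
    (\prod_(i <- D) F i ^+ m) * (u - v * F j ^+ m)); last by ring.
  by apply: PD => //; apply: PM.
have [u Pu] : exists u, family_ideal T F (r0 - outer B0 * u).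
  have [|u] := factor (enum (~: B0)) (enum_uniq _); first by move=> j;
    rewrite mem_enum inE.
  by rewrite big_enum /= => Pu; exists u; rewrite /outer;
    under eq_bigl do rewrite -in_setC.
exists u; apply: satI => B cardB; have [r Ir] := adj_f B cardB.
have Pr : family_ideal T F (r - outer B * u).
  apply: (outer_regular leTc sTB0).
  rewrite (_ : _ * _ = (outer B0 * r - outer B * r0) + outer B * (r0 - outer B0 * u));
    last by ring.
  by apply: PD; [exact: cross | exact: PM].
rewrite (_ : _ * _ = (outer B * f - r * h) + (r - outer B * u) * h); last by ring.
by apply: ID => //; apply/colonE.
Qed.

End Saturation.

End GenericFamily.

(** * Star ideals and their symbolic powers *)

Section Localization.
Local Open Scope ring_scope.

Variable A : idomainType.
Implicit Types (P J : A -> Prop).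

(** Clear denominators: a product of finitely many elements outside a prime ideal
stays outside. *)
Lemma ideal_localizationP P J f : is_prime_ideal P -> is_ideal J ->
  ideal_localization P J (tofrac f) <-> exists b, ~ P b /\ J (b * f).
Proof.
case=> -[P0 _ _] P1 PM idJ; have [J0 JD JM] := idJ.
have neq0 b : ~ P b -> tofrac b != 0.
  by move=> nPb; rewrite tofrac_eq0; apply: contra_notN nPb => /eqP->.
split; last first.
  case=> b [nPb Jbf]; exists [:: (tofrac 1 / tofrac b, tofrac (b * f))]; split.
    by move=> u; rewrite inE => /eqP->; split; [exists 1, b | exists (b * f)].
  rewrite big_seq1 /= tofracM tofrac1 mul1r mulKf //; exact: neq0.
case=> r [Pr sum_r].
suff [b [g [nPb Jg eq_g]]] : exists b g, [/\ ~ P b, J g &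
    tofrac b * (\sum_(u <- r) u.1 * u.2) = tofrac g].
  exists b; split=> //; move: eq_g; rewrite -sum_r -tofracM.
  by move/eqP; rewrite tofrac_eq => /eqP ->.
elim: r Pr {sum_r} => [|u r IHr] Pr.
  by exists 1, 0; rewrite big_nil mulr0 tofrac0.
have [|b [g [nPb Jg eq_g]]] := IHr; first by move=> v vr; apply: Pr; rewrite inE vr orbT.
have [[a [d [nPd u1]]] [x Jx u2]] := Pr u (mem_head _ _).
exists (b * d), (b * a * x + d * g); split.
- by move=> Pbd; case: (PM _ _ Pbd).
- by apply: JD; apply: JM.
- rewrite big_cons u1 u2 !(tofracM, tofracD) -eq_g; set y := \sum_(_ <- _) _.
  rewrite mulrDr; congr (_ + _); last by rewrite mulrA [tofrac d * _]mulrC.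
  rewrite -!mulrA; congr (_ * _); rewrite mulrCA; congr (_ * _).
  by rewrite mulVKf //; apply: neq0.
Qed.

End Localization.

Section StarIdeals.
Local Open Scope ring_scope.

Variables (A : idomainType) (s c : nat) (F : 'I_s -> A).
Implicit Types (T B : {set 'I_s}) (a : 'I_s -> nat) (f g : A).

Hypothesis prime_family : forall T, is_prime_ideal (family_ideal T F).
Hypothesis generic_family :
  forall T l, (#|T| <= c)%N -> l \notin T -> ~ family_ideal T F (F l).
(** For the prime ideals P_B this says that their powers are primary. *)
Hypothesis primary_family : forall B d f g, ~ family_ideal B F f ->
  ideal_pow (family_ideal B F) d (f * g) -> ideal_pow (family_ideal B F) d g.
Hypotheses (c_gt0 : (0 < c)%N) (lt_cs : (c < s)%N).

Definition star f : Prop := forall B, #|B| = c -> family_ideal B F f.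

Lemma star_is_ideal : is_ideal star.
Proof.
split=> [B _|f g If Ig B cB|r f If B cB]; have [P0 PD PM] := family_ideal_ideal B F => //.
  by apply: PD; auto.
by apply: PM; auto.
Qed.

(** A product that lies in every P_B' with B' <> B of the same size c, but not in
P_B: it isolates one component of the intersection. *)
Definition cofactor B : A := \prod_(j | j \notin B) F j.

Lemma cofactor_notin B : #|B| = c -> ~ family_ideal B F (cofactor B).
Proof. by move=> cB; apply: prime_prod => // j; apply: generic_family; rewrite cB. Qed.

Lemma star_cofactor B j : #|B| = c -> j \in B -> star (F j * cofactor B).
Proof.
move=> cB jB B' cB'; have [_ _ PM] := family_ideal_ideal B' F.
have [->|neqB] := eqVneq B' B.
  by rewrite mulrC; case: (family_ideal_ideal B F) => _ _; apply; apply: mem_family_ideal.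
have /subsetPn[i iB' iB] : ~~ (B' \subset B).
  by apply: contra neqB => sB; rewrite eqEcard sB cB cB' leqnn.
rewrite /cofactor (bigD1 i) //= mulrCA mulrC; apply: PM; exact: mem_family_ideal.
Qed.

(** The product F_j * cofactor B lies in the star ideal for j in B, and the
monomial contains at least d such factors F_j. *)
Lemma star_pow_monomial d B a : #|B| = c -> (d <= \sum_(j in B) a j)%N ->
  ideal_pow star d (monomial F a * cofactor B ^+ d).
Proof.
move=> cB; elim: d a => [|d IHd] a le_d; first exact: ideal_pow0.
have /existsP[j /andP[jB aj]] : [exists j, (j \in B) && (0 < a j)%N].
  apply: contraLR le_d => /existsPn a0; rewrite big1 // => j jB.
  by apply/eqP; have := a0 j; rewrite jB /= -leqNgt leqn0.
pose a' i := (a i - (i == j))%N.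
have aE : a =1 (fun i => (i == j) + a' i)%N.
  by move=> i; rewrite /a'; case: eqP => [->|_] /=; [rewrite subnKC | rewrite subn0].
have le_d' : (d <= \sum_(i in B) a' i)%N.
  rewrite -ltnS; apply: leq_trans le_d _.
  rewrite (eq_bigr _ (fun i _ => aE i)) big_split /= -add1n leq_add2r.
  by rewrite (bigD1 j) //= eqxx big1 // => i /andP[_ /negPf->].
rewrite (eq_monomial F aE) monomialD monomial1 exprS.
rewrite (_ : _ * _ = (F j * cofactor B) * (monomial F a' * cofactor B ^+ d));
  last by ring.
by apply: ideal_powS; [exact: star_cofactor | exact: IHd].
Qed.

Lemma star_colon_cofactor B : #|B| = c ->
  same_ideal (family_ideal B F) (colon star (cofactor B)).
Proof.
move=> cB f; have [_ _ primeB] := prime_family B; split=> [|starf].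
  have [I0 ID IM] := star_is_ideal.
  apply: (@family_ideal_least _ _ _ _ (fun f => star (f * cofactor B))).
    split=> [|x y Ix Iy|r x Ix]; first by rewrite mul0r.
      by rewrite mulrDl; apply: ID.
    by rewrite -mulrA; apply: IM.
  by move=> j jB; apply: star_cofactor.
by case: (primeB _ _ (starf B cB)) => // /(cofactor_notin cB).
Qed.

(** Let P be the annihilator of x modulo the intersection of the P_B.  If every
P_B contained in P contained x, then choosing for each other B an F_j with j in B
outside P would give a product y outside P with y * x in the star ideal.  So some
P_B contained in P does not contain x, and it contains P as P * x lies in P_B. *)
Lemma associated_prime_star P :
  associated_prime star P <-> exists2 B : {set 'I_s}, #|B| = c & same_ideal P
    (family_ideal B F).
Proof.
split; last first.
  case=> B cB samePB; split; last first.
    by exists (cofactor B); apply: (same_ideal_trans samePB); apply: star_colon_cofactor.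
  have [[P0 PD PM] P1 PP] := prime_family B; split.
  - split=> [|f g /samePB Pf /samePB Pg|r f /samePB Pf]; apply/samePB => //;
      first exact: PD.
    exact: PM.
  - by move/samePB.
  - by move=> f g /samePB/PP[] /samePB; [left | right].
case=> -[idP P1 PP] [x samePB]; have [P0 PD PM] := idP.
(* Either some P_B is as wanted, or a product y of elements outside P
   multiplies x into all the P_B with B in L. *)
have dichotomy (L : seq {set 'I_s}) :
    (exists B, [/\ #|B| = c, forall j, j \in B -> P (F j) & ~ family_ideal B F x]) \/
    (exists y, ~ P y /\ forall B, B \in L -> #|B| = c -> family_ideal B F (y * x)).
  elim: L => [|B L [|[y [nPy yx]]]]; [by right; exists 1 | by left |].
  have [cB|ncB] := eqVneq #|B| c; last first.
    right; exists y; split=> // B'; rewrite inE => /predU1P[-> /eqP|/yx //].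
    by rewrite (negPf ncB).
  have [[j [jB nPj]]|sub] := classic (exists j, j \in B /\ ~ P (F j)).
    right; exists (F j * y); split; first by case/PP.
    move=> B'; rewrite inE -mulrA; have [_ _ IM] := family_ideal_ideal B' F.
    case/predU1P=> [-> _|B'L cB']; last exact: IM (yx _ B'L cB').
    by rewrite mulrC; case: (family_ideal_ideal B F) => _ _; apply;
      apply: mem_family_ideal.
  have [Px|nPx] := classic (family_ideal B F x); last first.
    left; exists B; split=> // j jB; have [//|nPj] := classic (P (F j)).
    by case: sub; exists j.
  right; exists y; split=> // B'; rewrite inE => /predU1P[-> _|/yx //].
  by case: (family_ideal_ideal B F) => _ _; apply.
have [[B [cB subP nx]]|[y [nPy yx]]] := dichotomy (enum {set 'I_s}); last first.
  by case: nPy; apply/samePB => B cB; apply: yx => //; rewrite mem_enum.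
exists B => // f; split; last exact: family_ideal_least.
have [_ _ primeB] := prime_family B.
by move/samePB => /(_ B cB)/primeB[].
Qed.

Lemma symbolic_power_star_pow m B f : #|B| = c ->
  symbolic_power star m f -> ideal_pow (family_ideal B F) m f.
Proof.
move=> cB /(_ (family_ideal B F)) symf.
have /symf : associated_prime star (family_ideal B F).
  by apply/associated_prime_star; exists B.
case/(ideal_localizationP _ (prime_family B) (ideal_pow_ideal _ _)) => b [nPb].
move/(ideal_pow_mono (fun g starg => starg B cB)).
exact: primary_family.
Qed.

Lemma monomial_symbolic_power m a : admissible c m a ->
  symbolic_power star m (monomial F a).
Proof.
move=> adm_a P assP; have [B cB samePB] := (associated_prime_star P).1 assP.
case: assP => primeP _.
apply/(ideal_localizationP _ primeP (ideal_pow_ideal _ _)); exists (cofactor B ^+ m);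
  split.
  by move/samePB; apply: prime_exp => //; apply: cofactor_notin.
by rewrite mulrC; apply: star_pow_monomial => //; apply: adm_a.
Qed.

Lemma symbolic_power_is_ideal m : is_ideal (symbolic_power star m).
Proof.
have toJ P f : associated_prime star P ->
    ideal_localization P (ideal_pow star m) (tofrac f) <-> 
    exists b, ~ P b /\ ideal_pow star m (b * f).
  by case=> primeP _; apply: ideal_localizationP => //; apply: ideal_pow_ideal.
have [I0 ID IM] := ideal_pow_ideal star m.
split=> [P assP|f g symf symg P assP|r f symf P assP]; apply/(toJ P _ assP).
- exists 1; rewrite mulr0; split=> //; by case: assP => -[].
- have [b [nPb Ibf]] := (toJ P f assP).1 (symf P assP).
  have [d [nPd Idg]] := (toJ P g assP).1 (symg P assP).
  exists (b * d); split; first by case: assP => -[_ _ PP] _ /PP[].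
  by rewrite mulrDr -[b * d * g]mulrA [b * d]mulrC -mulrA; apply: ID; apply: IM.
- have [b [nPb Ibf]] := (toJ P f assP).1 (symf P assP).
  by exists b; rewrite mulrCA; split=> //; apply: IM.
Qed.

Lemma symbolic_power1_star : same_ideal (symbolic_power star 1) star.
Proof.
move=> f; split=> [symf B cB|starf P [primeP _]].
  by apply/(ideal_pow1 (family_ideal_ideal B F)); apply: symbolic_power_star_pow.
apply/(ideal_localizationP _ primeP (ideal_pow_ideal _ _)); exists 1; rewrite mul1r.
by split; [case: primeP | apply/(ideal_pow1 star_is_ideal)].
Qed.

Section Generators.

Variables (m : nat) (es : seq ('I_s -> nat)).
Hypothesis m_gt0 : (0 < m)%N.
Let e_ i := nth (fun=> 0%N) es i.
Let h := [seq monomial F a | a <- es].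

Hypothesis gen_es : forall i, (i < size es)%N -> exists t, gen_exp c m t (e_ i).
Hypothesis es_gen : forall t a, gen_exp c m t a -> exists2 i, (i < size es)%N & e_ i =1 a.
Hypothesis colon_es : forall i, (i < size es)%N -> exists2 T : {set 'I_s}, (#|T| < c)%N &
  same_ideal (colon (ideal_gen_seq (take i h)) h`_i) (family_ideal T F).

(** Induction along the filtration by the first i generators, starting from the
zero ideal. *)
Lemma saturated_take i : (i <= size es)%N -> saturated c F m (ideal_gen_seq (take i h)).
Proof.
elim: i => [_ f satf|i IHi lti].
  have [|B _ cB] := @superset_card _ (@set0 'I_s) c.
    by rewrite cards0 card_ord leq0n ltnW.
  rewrite take0 in satf *.
  apply: ideal_gen_mono (_ : family_ideal set0 F f) => [x [j]|]; first by rewrite inE.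
  apply: (outer_regular (m := m) prime_family generic_family _ (sub0set B)).
    by rewrite cards0.
  by apply: ideal_gen_mono (satf B cB) => x.
have [T ltTc colonT] := colon_es lti.
move=> f satf; have lti_h : (i < size h)%N by rewrite size_map.
have takeS g : ideal_gen_seq (take i.+1 h) g <->
    exists r, ideal_gen_seq (take i h) (g - r * h`_i).
  by rewrite (take_nth 0 lti_h); apply: ideal_gen_seq_rcons.
apply/takeS; apply: (saturated_adjoin prime_family generic_family m_gt0 _ (ltnW lt_cs)
  ltTc colonT).
- exact: ideal_gen_ideal.
- exact: IHi (ltnW lti).
- by move=> B cB; apply/takeS; apply: satf.
Qed.

Lemma mem_ideal_of_admissible a : admissible c m a -> ideal_gen_seq h (monomial F a).
Proof.
case/(admissible_gen_exp c_gt0 lt_cs m_gt0) => t [g [/es_gen[i lti eq_g] le_g]].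
have [r ->] : exists r, monomial F a = r * monomial F (e_ i).
  by apply: monomial_leq => j; rewrite eq_g.
have [_ _ IM] := ideal_gen_ideal (fun x => x \in h); apply: IM; apply: mem_ideal_gen.
rewrite -(nth_map _ 0 (monomial F)) //; apply: mem_nth; by rewrite size_map.
Qed.

(** By saturation it suffices to show that outer B * f lies in the ideal.  Since f
is in P_B ^ m, this product is a combination of monomials F^a whose exponents are
at least m outside B and sum to m over B; such exponents are admissible. *)
Lemma mem_ideal_of_pow f :
  (forall B, #|B| = c -> ideal_pow (family_ideal B F) m f) -> ideal_gen_seq h f.
Proof.
move=> powf; have := saturated_take (leqnn (size es)).
rewrite take_oversize ?size_map //; apply=> B cB.
have [I0 ID IM] := ideal_gen_ideal (fun x => x \in h).
suff claim d g b : ideal_pow (family_ideal B F) d g ->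
    (m <= \sum_(j in B) b j + d)%N -> ideal_gen_seq h (outer F m B * monomial F b * g).
  have mon0 : monomial F (fun=> 0%N) = 1 by apply: big1 => j _; apply: expr0.
  have := claim m f (fun=> 0%N) (powf B cB); rewrite mon0 mulr1.
  by apply; apply: leq_addl.
elim: d b g => [|d IHd] b g.
  move=> _; rewrite addn0 => le_m; rewrite mulrC; apply: IM.
  have -> : outer F m B = monomial F (fun j => if j \in B then 0 else m)%N.
    rewrite /monomial (bigID (mem B)) /= big1 ?mul1r => [|j ->]; last exact: expr0.
    by apply: eq_bigr => j /negPf->.
  rewrite -monomialD; apply: mem_ideal_of_admissible => C cC.
  have [->|neqC] := eqVneq C B.
    by rewrite (eq_bigr b) // => j ->.
  have /subsetPn[i iC iB] : ~~ (C \subset B).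
    by apply: contra neqC => sC; rewrite eqEcard sC cB cC leqnn.
  by rewrite (bigD1 i) //= (negPf iB) -addnA leq_addr.
move=> powg le_m; move: g powg.
apply: ideal_pow_least.
  split=> [|x y Jx Jy|r x Jx]; first by rewrite mulr0.
    by rewrite mulrDr; apply: ID.
  by rewrite mulrCA; apply: IM.
move=> x g Px powg; move: x Px; apply: family_ideal_least.
  split=> [|x y Jx Jy|r x Jx]; first by rewrite mul0r mulr0.
    by rewrite mulrDl mulrDr; apply: ID.
  by rewrite -[r * x * g]mulrA mulrCA; apply: IM.
move=> j jB; rewrite -(monomial1 F j) mulrA -[_ * monomial F b * _]mulrA -monomialD.
apply: IHd => //; apply: leq_trans le_m _.
rewrite big_split /= addnS -addn1 -addnAC leq_add2r leq_add2l.
by rewrite (bigD1 j) //= eqxx.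
Qed.

Lemma symbolic_power_star : same_ideal (ideal_gen_seq h) (symbolic_power star m).
Proof.
move=> f; split=> [|symf].
  apply: ideal_gen_least; first exact: symbolic_power_is_ideal.
  move=> x /(nthP 0)[i]; rewrite size_map => lti <- {x}.
  rewrite (nth_map (fun=> 0%N)) //; have [t gen_i] := gen_es lti.
  exact/monomial_symbolic_power/(gen_exp_admissible gen_i).
by apply: mem_ideal_of_pow => B cB; apply: symbolic_power_star_pow.
Qed.

End Generators.

End StarIdeals.

(** * Ideals of linear forms *)

Section LinearForms.
Local Open Scope ring_scope.

Variables (k : fieldType) (n : nat).
Local Notation R := {mpoly k[n.+1]}.

(** Induction on polynomials that multiplies by one variable at a time, so that
degrees along a filtration can be tracked. *)
Lemma mpoly_ring_ind (Q : R -> Prop) :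
  (forall a, Q a%:MP) -> (forall f g, Q f -> Q g -> Q (f + g)) ->
  (forall i f, Q f -> Q ('X_i * f)) -> forall f, Q f.
Proof.
move=> QC QD QX; apply: mpolyind => [|a m f _ _]; first by rewrite -mpolyC0; apply: QC.
apply: QD => {f}; have [d] := ubnP (mdeg m); elim: d m => // d IHd m lt_d.
have [->|] := eqVneq m 0%MM; first by rewrite mpolyX0 -mul_mpolyC mulr1; apply: QC.
rewrite -mdeg_eq0 mdegE => m_neq0.
have [i mi] : exists i, (0 < m i)%N.
  apply/existsP; apply: contraR m_neq0 => /existsPn m0; rewrite big1 // => i _.
  by apply/eqP; have := m0 i; rewrite -leqNgt leqn0.
have mE : m = (U_(i) + (m - U_(i)))%MM.
  by apply/mnmP => j; rewrite mnmDE mnmBE mnm1E; case: eqP => [<-|_];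
    rewrite ?subnKC ?subn0.
rewrite mE mpolyXD scalerAr; apply: QX; apply: IHd.
by move: lt_d; rewrite {1}mE mdegD mdeg1.
Qed.

Definition linear_form (v : 'rV[k]_n.+1) : R := \sum_i v 0 i *: 'X_i.

Lemma linear_form0 : linear_form 0 = 0.
Proof. by apply: big1 => i _; rewrite mxE scale0r. Qed.

Lemma linear_formD u v : linear_form (u + v) = linear_form u + linear_form v.
Proof. by rewrite -big_split; apply: eq_bigr => i _; rewrite mxE scalerDl. Qed.

Lemma linear_formZ a v : linear_form (a *: v) = a *: linear_form v.
Proof. by rewrite scaler_sumr; apply: eq_bigr => i _; rewrite mxE scalerA. Qed.

Lemma linear_form_mulmx s (w : 'rV_s) (M : 'M_(s, n.+1)) :
  linear_form (w *m M) = \sum_j w 0 j *: linear_form (row j M).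
Proof.
rewrite mulmx_sum_row; elim/big_rec2: _ => [|j x y _ IH]; first exact: linear_form0.
by rewrite linear_formD linear_formZ IH.
Qed.

Lemma linear_homogE f : f \is 1.-homog -> f = linear_form (\row_i f@_U_(i)).
Proof.
move=> homf; apply/mpolyP => m.
rewrite /linear_form raddf_sum /=.
under eq_bigr do rewrite mcoeffZ mcoeffX mxE.
have [/eqP/mdeg1P[i /eqP->]|neq1] := eqVneq (mdeg m) 1%N.
  rewrite (bigD1 i) //= eqxx mulr1 big1 ?addr0 // => j /negPf neq_ji.
  by rewrite eq_mnm1 neq_ji mulr0.
rewrite (dhomog_nemf_coeff homf) // big1 // => i _.
by rewrite (_ : (_ == m) = false) ?mulr0 //; apply: contraNF neq1 => /eqP <-;
  rewrite mdeg1.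
Qed.

Section Deformation.

Variables (s : nat) (F : 'I_s -> R).
Hypothesis linF : forall j, F j \is 1.-homog.

(** The l_i are the images of the variables under a linear projection onto the
span of the F_j with j in T. *)
Lemma linear_projection (T : {set 'I_s}) : exists l : 'I_n.+1 -> R,
  [/\ forall i, family_ideal T F (l i),
      forall j, j \in T -> \sum_i (F j)@_U_(i) *: l i = F j &
      forall j, exists kappa : 'I_s -> k,
        \sum_i (F j)@_U_(i) *: l i = \sum_(t in T) kappa t *: F t].
Proof.
pose v j : 'rV[k]_n.+1 := \row_i (F j)@_U_(i).
have FE j : F j = linear_form (v j) := linear_homogE (linF j).
pose M := \matrix_j (if j \in T then v j else 0).
have rowM w : linear_form (w *m M) = \sum_(t in T) w 0 t *: F t.
  rewrite linear_form_mulmx [RHS]big_mkcond; apply: eq_bigr => t _; rewrite rowK.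
  by case: ifP => _; rewrite ?FE // linear_form0 scaler0.
have spanE j : \sum_i (F j)@_U_(i) *: linear_form (row i (pinvmx M *m M)) =
               linear_form (v j *m pinvmx M *m M).
  by rewrite -mulmxA linear_form_mulmx; apply: eq_bigr => i _; rewrite mxE.
(* pinvmx M *m M is a projection onto the row space of M. *)
exists (fun i => linear_form (row i (pinvmx M *m M))); split=> [i|j jT|j].
- rewrite row_mul rowM; apply: ideal_sum; first exact: family_ideal_ideal.
  move=> t tT; rewrite -mul_mpolyC; have [_ _] := family_ideal_ideal T F; apply.
  exact: mem_family_ideal.
- by rewrite spanE mulmxKpV -?FE //; apply: (eq_row_sub j); rewrite rowK jT.
- by exists (fun t => (v j *m pinvmx M) 0 t); rewrite spanE rowM.
Qed.

Section Deform.
Variables (T : {set 'I_s}) (l : 'I_n.+1 -> R).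
Hypothesis lT : forall i, family_ideal T F (l i).
Hypothesis lF : forall j, j \in T -> \sum_i (F j)@_U_(i) *: l i = F j.

(** The substitution X_i |-> (X_i - l_i) + l_i * t, with values in R[t].  It is
the identity at t = 1, a retraction that kills P_T at t = 0, and it multiplies
F_j by t for j in T. *)
Variable deform : {rmorphism R -> {poly R}}.
Hypothesis deformC : forall a, deform a%:MP = a%:MP%:P.
Hypothesis deformX : forall i, deform 'X_i = ('X_i - l i)%:P + (l i)%:P * 'X.

Lemma deform_linear f : f \is 1.-homog ->
  deform f = (f - \sum_i f@_U_(i) *: l i)%:P + (\sum_i f@_U_(i) *: l i)%:P * 'X.
Proof.
move=> homf; have fE : f = \sum_i f@_U_(i) *: 'X_i.
  by rewrite {1}(linear_homogE homf); apply: eq_bigr => i _; rewrite mxE.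
rewrite {1 2}fE rmorph_sum -sumrB !(rmorph_sum polyC) /=.
rewrite mulr_suml -big_split /=.
by apply: eq_bigr => i _;
  rewrite -!mul_mpolyC -mulrBr rmorphM deformC deformX !polyCM mulrDr mulrA.
Qed.

Lemma deform_horner1 f : (deform f).[1] = f.
Proof.
elim/mpoly_ring_ind: f => [a|f g IHf IHg|i f IHf].
- by rewrite deformC hornerC.
- by rewrite rmorphD hornerD IHf IHg.
- by rewrite rmorphM hornerM IHf deformX !hornerE subrK.
Qed.

(** Each factor t brings a factor l_i in P_T: the image of the deformation is in
the Rees algebra of P_T. *)
Lemma deform_coef_pow d f : ideal_pow (family_ideal T F) d (deform f)`_d.
Proof.
elim/mpoly_ring_ind: f d => [a|f g IHf IHg|i f IHf] d.
- have [I0 _ _] := ideal_pow_ideal (family_ideal T F) d.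
  by rewrite deformC coefC; case: eqP => // ->; apply: ideal_pow0.
- by rewrite rmorphD coefD; have [_ ID _] := ideal_pow_ideal (family_ideal T F) d;
    apply: ID.
- have [_ ID IM] := ideal_pow_ideal (family_ideal T F) d.
  rewrite rmorphM deformX mulrDl coefD coefCM -mulrA coefCM coefXM; apply: ID.
    by apply: IM.
  case: d {IM} IHf => [|d] IHf /=; first by apply: ideal_pow0.
  by apply: ideal_powS.
Qed.

Lemma deform_family_coef0 f : family_ideal T F f -> (deform f)`_0 = 0.
Proof.
apply: (@family_ideal_least _ _ _ _ (fun f => (deform f)`_0 = 0)).
  split=> [|x y x0 y0|r x x0]; first by rewrite rmorph0 coef0.
    by rewrite rmorphD coefD x0 y0 addr0.
  by rewrite rmorphM coef0M x0 mulr0.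
move=> j jT; rewrite deform_linear // coefD coefC eqxx coefMX eqxx addr0.
by rewrite lF // subrr.
Qed.

(** If the image of f is divisible by t ^ m, then f, the sum of its coefficients,
is a sum of elements of the powers of P_T with exponent at least m. *)
Lemma deform_pow m f : ideal_pow (family_ideal T F) m f <->
  forall d, (d < m)%N -> (deform f)`_d = 0.
Proof.
split; last first.
  move=> low0; have [I0 _ _] := ideal_pow_ideal (family_ideal T F) m.
  rewrite -[f]deform_horner1 horner_coef; apply: ideal_sum; first exact: ideal_pow_ideal.
  move=> d _; rewrite expr1n mulr1; have [lt_d|ge_d] := ltnP d m; first by rewrite low0.
  exact: ideal_pow_leq ge_d _ (deform_coef_pow _ _).
elim: m f => // m IHm; apply: ideal_pow_least.
  split=> [d _|x y x0 y0 d lt_d|r x x0 d lt_d].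
  - by rewrite rmorph0 coef0.
  - by rewrite rmorphD coefD x0 // y0 // addr0.
  - rewrite rmorphM coefM big1 // => i _; rewrite x0 ?mulr0 //.
    exact: leq_ltn_trans (leq_subr _ _) lt_d.
move=> f g Pf /IHm g0 d; rewrite ltnS => le_d.
rewrite rmorphM coefM big1 // => -[[|i] lt_i] _ /=.
  by rewrite deform_family_coef0 // mul0r.
by rewrite g0 ?mulr0 //; move: lt_i le_d; clear; lia.
Qed.

Lemma deform_family f : family_ideal T F f <-> (deform f)`_0 = 0.
Proof.
have [to1 of1] := ideal_pow1 (family_ideal_ideal T F) f.
split=> [|f0]; first exact: deform_family_coef0.
by apply: to1; apply/deform_pow => -[].
Qed.

Lemma deform_prime : is_prime_ideal (family_ideal T F).
Proof.
split; first exact: family_ideal_ideal.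
  by move/deform_family/eqP; rewrite rmorph1 coefC eqxx oner_eq0.
move=> f g /deform_family/eqP; rewrite rmorphM coef0M mulf_eq0.
by case/orP=> /eqP; [left | right]; apply/deform_family.
Qed.

(** The t-adic valuation on R[t] is additive, R being a domain, and that of the
image of f is 0. *)
Lemma deform_primary m f g : ~ family_ideal T F f ->
  ideal_pow (family_ideal T F) m (f * g) -> ideal_pow (family_ideal T F) m g.
Proof.
move=> nPf /deform_pow fg0; apply/deform_pow => d.
have {nPf}f0 : (deform f)`_0 != 0 by apply/eqP => /deform_family.
have [w] := ubnP d; elim: w d => // w IHw d le_d lt_d.
have := fg0 d lt_d; rewrite rmorphM coefM big_ord_recl subn0 big1 => [|[i lt_i] _].
  by rewrite addr0 => /eqP; rewrite mulf_eq0 (negPf f0) => /eqP.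
by rewrite /= IHw ?mulr0 //; move: lt_i le_d lt_d; rewrite /bump; clear; lia.
Qed.

End Deform.

Lemma deformation_exists (l : 'I_n.+1 -> R) : exists D : {rmorphism R -> {poly R}},
  (forall a, D a%:MP = a%:MP%:P) /\
  (forall i, D 'X_i = ('X_i - l i)%:P + (l i)%:P * 'X).
Proof.
exists (mmap (polyC \o @mpolyC n.+1 k) (fun i => ('X_i - l i)%:P + (l i)%:P * 'X)).
by split=> [a|i]; [rewrite /= mmapC | rewrite /= mmapX mmap1U].
Qed.

Lemma linear_family_prime T : is_prime_ideal (family_ideal T F).
Proof.
have [l [lT lF _]] := linear_projection T; have [D [DC DX]] := deformation_exists l.
exact: (deform_prime lT lF DC DX).
Qed.

Lemma linear_family_primary T m f g : ~ family_ideal T F f ->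
  ideal_pow (family_ideal T F) m (f * g) -> ideal_pow (family_ideal T F) m g.
Proof.
have [l [lT lF _]] := linear_projection T; have [D [DC DX]] := deformation_exists l.
exact: (deform_primary lT lF DC DX).
Qed.

(** At t = 0 the deformation sends F_j to F_j minus its projection. *)
Lemma linear_family_span T j : family_ideal T F (F j) ->
  exists kappa : 'I_s -> k, F j = \sum_(t in T) kappa t *: F t.
Proof.
have [l [lT lF lspan]] := linear_projection T; have [D [DC DX]] := deformation_exists l.
have [kappa eqk] := lspan j; move/(deform_family_coef0 lF DC DX) => D0; exists kappa.
move: D0; rewrite (deform_linear DC DX (linF j)) coefD coefC coefMX /= addr0 eqk.
by move/eqP; rewrite subr_eq0 => /eqP.
Qed.

End Deformation.

(** * Linear independence and minimal homogeneous generators *)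

(** If the last form with a nonzero coefficient were a combination of the previous
ones, 1 would be in their ideal, by regularity applied to F_j * 1. *)
Lemma regular_sequence_independent (s : nat) (F : 'I_s -> R) (e : seq 'I_s) (kappa : 'I_s
  -> k) :
  regular_sequence [seq F j | j <- e] -> \sum_(j <- e) kappa j *: F j = 0 ->
  forall j, j \in e -> kappa j = 0.
Proof.
elim/last_ind: e => // e j0 IHe; rewrite map_rcons => -[not1 reg].
rewrite -{1}cats1 big_cat big_seq1 /= => sum0.
have [I0 _ IM] := ideal_gen_ideal (fun x => x \in [seq F j | j <- e]).
have kj0 : kappa j0 = 0.
  apply/eqP; apply/negPn/negP => nz; apply: not1.
  have := reg (size e); rewrite size_rcons size_map ltnSn => /(_ isT 1).
  rewrite -cats1 take_size_cat ?size_map // nth_cat size_map ltnn subnn /= mulr1.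
  move=> /(_ _)-H; apply: (ideal_gen_mono (S := fun x => x \in [seq F j | j <- e])).
    by move=> x xe; rewrite mem_cat xe.
  apply: H; have -> : F j0 = (- (kappa j0)^-1)%:MP * \sum_(j <- e) kappa j *: F j.
    rewrite (_ : \sum_(j <- e) _ = - (kappa j0 *: F j0)); last first.
      by apply/eqP; rewrite -addr_eq0 sum0.
    by rewrite mul_mpolyC scaleNr scalerN opprK scalerA mulVf ?scale1r.
  apply: (IM); rewrite big_seq; apply: ideal_sum; first exact: ideal_gen_ideal.
  move=> j je; rewrite -mul_mpolyC; apply: IM; apply: mem_ideal_gen; exact: map_f.
move: sum0; rewrite kj0 scale0r addr0 => sum0 j; rewrite mem_rcons inE => /predU1P[->//|].
apply: IHe => //; split=> [in1|i lti f].
  apply: not1; apply: ideal_gen_mono in1 => x xe; by rewrite mem_rcons inE xe orbT.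
have := reg i; rewrite size_rcons ltnS (ltnW lti) => /(_ isT f).
by rewrite nth_rcons lti -cats1 takel_cat // ltnW.
Qed.

Lemma pihomogM d e (p q : R) : q \is e.-homog ->
  pihomog mdeg d (p * q) = if (e <= d)%N then pihomog mdeg (d - e) p * q else 0.
Proof.
move=> homq; elim/mpolyind: p => [|a m p _ _ IHp].
  by rewrite mul0r !pihomog0 mul0r if_same.
rewrite mulrDl !pihomogD IHp -scalerAl !linearZ /= pihomogX.
have homXq : 'X_[m] * q \is (mdeg m + e).-homog by apply: dhomogM; rewrite ?dhomogX.
have [le_ed|lt_de] := leqP e d; last first.
  by rewrite (pihomog_ne0 _ homXq) ?scaler0 ?addr0 //; move: lt_de; clear; lia.
rewrite mulrDl; congr (_ + _); case: eqP => [eqm|neqm].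
  by rewrite pihomog_dE ?scalerAl //; move: homXq; rewrite eqm subnK.
rewrite (pihomog_ne0 _ homXq) ?scaler0 ?mul0r //.
by apply/eqP => eqd; apply: neqm; rewrite -eqd addnK.
Qed.

(** Suppose that h_i is a combination of other h_l, and take its component of
degree d i.  The last h_l that occurs has either l < i, which is excluded, or
the degree of h_i and a constant coefficient; then it could be expressed by the
previous ones. *)
Lemma homogeneous_minimal_generating (h : seq R) (d : nat -> nat) :
  (forall i, (i < size h)%N -> h`_i \is (d i).-homog) ->
  (forall i j, (i <= j < size h)%N -> (d i <= d j)%N) ->
  (forall i, (i < size h)%N -> ~ ideal_gen_seq (take i h) h`_i) ->
  minimal_generating_seq (ideal_gen_seq h) h.
Proof.
move=> homh incr irred.
have mem_take i j : (i < j)%N -> (j <= size h)%N -> h`_i \in take j h.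
  by move=> ltij lej; rewrite -(nth_take 0 ltij) mem_nth // size_takel.
(* The ideal of the h_l with l < K, h_i being left out. *)
pose G i K := ideal_gen (fun x => exists l, [/\ (l < K)%N, l <> i & x = h`_l]).
have graded i K e f : (K <= size h)%N -> G i K f -> G i K (pihomog mdeg e f).
  move=> leK [r [Sr ->]]; rewrite raddf_sum big_seq; apply: ideal_sum;
    first exact: ideal_gen_ideal.
  move=> u /Sr[_ [l [ltl li ->]]] /=;
    have [G0 _ GM] := ideal_gen_ideal (fun x => exists l, [/\ (l < K)%N, l <> i & x =
      h`_l]).
  rewrite (pihomogM _ _ (homh l _)); last exact: leq_trans leK.
  case: ifP => // _; apply: GM; apply: mem_ideal_gen; by exists l.
have notG i K : (i < size h)%N -> (K <= size h)%N -> ~ G i K h`_i.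
  move=> lti; elim: K => [_ [r [Sr eqh]]|K IHK ltK GK].
    apply: (irred i lti); rewrite eqh big_seq; apply: ideal_sum;
      first exact: ideal_gen_ideal.
    by move=> u /Sr[_ [l []]].
  have [leKi|ltiK] := leqP K i.
    apply: (irred i lti); apply: ideal_gen_mono GK => x [l [ltl li ->]].
    by apply: mem_take; [move: ltl leKi li; clear; lia | exact: ltnW].
  have idG := ideal_gen_ideal (fun x => exists l, [/\ (l < K)%N, l <> i & x = h`_l]).
  have [r Gr] : exists r, G i K (h`_i - r * h`_K).
    apply: (ideal_gen_least (adjoin_ideal h`_K idG)) GK => x [l [ltl li ->]].
    have [eql|neql] := eqVneq l K.
      by exists 1; rewrite mul1r eql subrr; case: idG.
    exists 0; rewrite mul0r subr0; apply: mem_ideal_gen; exists l; split=> //.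
    by rewrite ltn_neqAle neql -ltnS.
  have := graded _ _ (d i) _ (ltnW ltK) Gr.
  rewrite pihomogB (pihomog_dE (homh i lti)) (pihomogM _ _ (homh K ltK)).
  case: ifP => [leK|_]; last by rewrite subr0; apply/IHK/ltnW.
  have -> : (d i - d K = 0)%N by apply/eqP; rewrite subn_eq0 incr // ltnW.
  have [a ->] : exists a, pihomog mdeg 0 r = a%:MP.
    exists (pihomog mdeg 0 r)@_0; apply: msize1_polyC.
    rewrite mmeasureE; apply/bigmax_leqP_seq => m /(dhomog_mf (pihomogP mdeg 0 r)) eqm _.
    by rewrite eqm.
  have [->|nz] := eqVneq a 0; first by rewrite mpolyC0 mul0r subr0; apply/IHK/ltnW.
  move=> {}Gr; apply: (irred K ltK).
  have [_ ID IM] := ideal_gen_ideal (fun x => x \in take K h).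
  have -> : h`_K = (a^-1)%:MP * (h`_i - (h`_i - a%:MP * h`_K)).
    by rewrite subKr mulrA -mpolyCM mulVf // mpolyC1 mul1r.
  apply: IM; apply: ideal_sub; first exact: ideal_gen_ideal.
    by apply: mem_ideal_gen; apply: mem_take => //; apply: ltnW.
  by apply: ideal_gen_mono Gr => x [l [ltl _ ->]]; apply: mem_take => //; apply: ltnW.
split=> //.
- apply/(uniqP 0) => i j; rewrite !inE => lti ltj eqij.
  have [ltij|ltji|//] := ltngtP i j.
    by case: (irred j ltj); rewrite -eqij; apply: mem_ideal_gen; apply: mem_take;
      rewrite // ltnW.
  by case: (irred i lti); rewrite eqij; apply: mem_ideal_gen; apply: mem_take;
    rewrite // ltnW.
- move=> S subS sameS x xh; have [//|nSx] := classic (S x); exfalso.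
  have ltx : (index x h < size h)%N by rewrite index_mem.
  apply: (notG _ _ ltx (leqnn _)); rewrite nth_index //.
  have /sameS : ideal_gen_seq h x by apply: mem_ideal_gen.
  apply: ideal_gen_mono => y Sy; have yh := subS y Sy; exists (index y h).
  rewrite index_mem nth_index //; split=> // eqi; apply: nSx.
  by rewrite -(nth_index 0 xh) -eqi nth_index.
Qed.

End LinearForms.

(** * Linear star configurations *)

Section LinearStars.
Local Open Scope ring_scope.

Variables (k : fieldType) (n : nat).
Local Notation R := {mpoly k[n.+1]}.

Lemma same_linear_quotients (I J : R -> Prop) : same_ideal I J ->
  has_linear_quotients I -> has_linear_quotients J.
Proof.
move=> sameIJ [h [homh [uniqh genI minI] quoh]]; exists h; split=> //; split=> //.
  exact: same_ideal_trans sameIJ.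
move=> S subS sameS; apply: minI => //; apply: same_ideal_trans sameS _.
by move=> f; split=> /sameIJ.
Qed.

Section Star.

Variables (c s : nat) (F : 'I_s -> R).
Hypothesis linF : forall j, F j \is 1.-homog.
Hypothesis genericF :
  forall (T : {set 'I_s}) l, (#|T| <= c)%N -> l \notin T -> ~ family_ideal T F (F l).
Hypotheses (c_gt0 : (0 < c)%N) (lt_cs : (c < s)%N).

Lemma monomial_homog a : monomial F a \is (\sum_j a j)%N.-homog.
Proof.
rewrite /monomial; elim/big_rec2: _ => [|j d f _ homf]; first exact: dhomog1.
by apply: dhomogM homf; rewrite -[X in X.-homog]mul1n; apply: dhomogMn.
Qed.

Lemma symbolic_power_linear_quotients m : (0 < m)%N ->
  has_linear_quotients (symbolic_power (star_ideal c F) m).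
Proof.
move=> m_gt0; have primeF := linear_family_prime linF.
have [es [gen_es es_gen sum_es colon_es]] := gen_exp_enumeration c_gt0 lt_cs m_gt0.
pose h := [seq monomial F a | a <- es].
have colonh i : (i < size es)%N -> exists2 T : {set 'I_s}, (#|T| < c)%N &
    same_ideal (colon (ideal_gen_seq (take i h)) h`_i) (family_ideal T F).
  move=> lti; have [T [ltT wit sep]] := colon_es i lti; exists T => //.
  by apply: (monomial_colon primeF genericF lti (ltnW ltT) wit sep).
have homh i : (i < size h)%N -> h`_i \is (\sum_j nth (fun=> 0%N) es i j)%N.-homog.
  by rewrite size_map => lti; rewrite (nth_map (fun=> 0%N)) //; apply: monomial_homog.
apply: (@same_linear_quotients (ideal_gen_seq h)).
  exact: (symbolic_power_star primeF genericF (linear_family_primary linF) c_gt0 lt_cs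
    m_gt0 gen_es es_gen colonh).
exists h; split.
- by move=> f /(nthP 0)[i lti <-]; apply: homogE (homh i lti).
- apply: homogeneous_minimal_generating homh _ _ => [i j|i]; rewrite size_map.
    exact: sum_es.
  move=> lti Jh; have [T _ colonT] := colonh i lti.
  have [_ not1 _] := primeF T; apply/not1/colonT.
  by rewrite /colon mul1r.
- move=> i /andP[_]; rewrite size_map => /colonh[T _ colonT].
  by exists (fun x => exists2 j, j \in T & x = F j); split=> // _ [j _ ->].
Qed.

End Star.

Lemma star_family_linear (c s : nat) (F : 'I_s -> R) :
  star_family c F -> linear_family F -> forall j, F j \is 1.-homog.
Proof.
by case=> homF _ linF j; have := homF j; rewrite homog_msize linF.
Qed.

(** T and l are contained in a set of c+1 indices, whose forms are linearly
independent. *)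
Lemma star_family_generic (c s : nat) (F : 'I_s -> R) : (c < s)%N ->
  star_family c F -> linear_family F ->
  forall (T : {set 'I_s}) l, (#|T| <= c)%N -> l \notin T -> ~ family_ideal T F (F l).
Proof.
move=> lt_cs starF linF T l leT lT.
move/(linear_family_span (star_family_linear starF linF)) => [kappa Fl].
have [|B sub cB] := @superset_card _ (l |: T) c.+1.
  by rewrite cardsU1 lT card_ord lt_cs andbT.
have [_ /(_ B cB) regB] := starF.
pose kappa' j := if j == l then -1 else if j \in T then kappa j else 0.
have lB : l \in B by apply: (subsetP sub); rewrite setU11.
have := regular_sequence_independent regB (kappa := kappa') _ (j := l).
rewrite mem_enum lB /kappa' eqxx => H.
have /eqP : (-1 : k) = 0; last by rewrite oppr_eq0 oner_eq0.
apply: H => //; rewrite big_enum /= (bigD1 l) //= eqxx scaleN1r.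
apply/eqP; rewrite addrC subr_eq0 eq_sym {1}Fl; apply/eqP.
rewrite [RHS](bigID (mem T)) /= [X in _ + X]big1 ?addr0 => [|j /andP[/andP[_ /negPf->]
  /negPf->]]; last first.
  by rewrite scale0r.
apply: congr_big => // [j|j jT].
  have [jT|] := boolP (j \in T); last by rewrite andbF.
  have jl : j != l by apply: contraNneq lT => <-.
  by rewrite (subsetP sub) ?inE ?jT ?orbT //= jl.
by rewrite jT (_ : (j == l) = false) //; apply: contraNF lT => /eqP <-.
Qed.

Lemma variables_linear j : @variables k n j \is 1.-homog.
Proof. by rewrite dhomogX; apply/eqP; apply: mdeg1. Qed.

(** Evaluate at the point with coordinates 0 on T and 1 elsewhere. *)
Lemma variables_generic (T : {set 'I_n.+1}) l : l \notin T ->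
  ~ family_ideal T (@variables k n) (@variables k n l).
Proof.
move=> lT; pose v i : k := (i \notin T)%:R.
have eval0 f : family_ideal T (@variables k n) f -> meval v f = 0.
  apply: (@family_ideal_least _ _ _ _ (fun f => meval v f = 0)).
    split=> [|x y x0 y0|r x x0]; first by rewrite meval0.
      by rewrite mevalD x0 y0 addr0.
    by rewrite mevalM x0 mulr0.
  by move=> j jT; rewrite /variables mevalXU /v jT.
by move/eval0/eqP; rewrite /variables mevalXU /v lT oner_eq0.
Qed.

End LinearStars.

Theorem corollary6p14 (k : fieldType) (n : nat) :
  (forall (c s : nat) (F : 'I_s -> {mpoly k[n.+1]}),
     1 <= c -> c < s -> star_family c F -> linear_family F ->
     forall m : nat, 1 <= m ->
       has_linear_quotients (symbolic_power (star_ideal c F) m))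
  /\
  (forall c : nat, 1 <= c -> c < n.+1 ->
     has_linear_quotients (star_ideal c (@variables k n)) /\
     forall m : nat, 1 <= m ->
       has_linear_quotients (symbolic_power (star_ideal c (@variables k n)) m)).
Proof.
split=> [c s F c_gt0 lt_cs starF linF m m_gt0|c c_gt0 lt_cn].
  apply: symbolic_power_linear_quotients => //;
    first exact: (star_family_linear starF linF).
  exact: star_family_generic.
have linX := @variables_linear k n.
have genX (T : {set 'I_n.+1}) l (_ : #|T| <= c) := @variables_generic k n T l.
have quo m := symbolic_power_linear_quotients linX genX c_gt0 lt_cn (m := m).
split=> //; apply: same_linear_quotients (quo 1 isT).
exact: (symbolic_power1_star (linear_family_prime linX) genX (linear_family_primary
  linX)).
Qed.
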